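(* Let $w\in\mathcal W$ and $g\in\mathcal D$. If the Volterra operator $T_g$ is bounded on $\mathcal H^2_w$, then the Hankel form $H_g$ is bounded on $\mathcal H^2_w\times\mathcal H^2_w$.
   Context: $\mathcal D$ is the class of functions represented by a convergent Dirichlet series in some half-plane. Weights: $w=(w_n)_{n\ge1}$ belongs to $\mathcal W$ if, for some real $\beta>0$, either $w_n=[d(n)]^\beta$ for all $n$ ($d(n)$ the number of divisors of $n$), or $w_n=d_{\beta+1}(n)$ for all $n$, where $\zeta(s)^\gamma=\sum_{n\ge1}d_\gamma(n)n^{-s}$. $\mathcal H^2_w$ is the Hilbert space of Dirichlet series $f(s)=\sum_{n\ge1}a_n n^{-s}$ with $\|f\|_{\mathcal H^2_w}^2=\sum_{n\ge1}|a_n|^2/w_n<\infty$; its inner product is $\langle \sum a_nn^{-s},\sum b_nn^{-s}\rangle_{\mathcal H^2_w}=\sum_{n}a_n\overline{b_n}/w_n$. Volterra operator: $T_gf(s)=-\int_s^{+\infty}f(u)g'(u)\,du$, $\Re s>1/2$; in terms of coefficients, if $f=\sum a_nn^{-s}$ and $g=\sum b_nn^{-s}$, then $T_gf(s)=\sum_{n\ge2}\frac1{\log n}\big(\sum_{k\mid n,\,k<n}a_k b_{n/k}\log(n/k)\big)n^{-s}$. The Hankel form of symbol $g$ is $H_g(fh)=\langle fh,g\rangle_{\mathcal H^2_w}$; it is bounded on $\mathcal H^2_w\times\mathcal H^2_w$ if there is a constant $C$ with $|H_g(fh)|\le C\|f\|_{\mathcal H^2_w}\|h\|_{\mathcal H^2_w}$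 for all Dirichlet polynomials $f,h$ (so that it extends by density to $f,h\in\mathcal H^2_w$). *)

(* Defs.v *)
From HB Require Import structures.
From mathcomp Require Import all_boot all_order all_algebra.
From mathcomp Require Import all_classical all_reals all_analysis.
From mathcomp Require Import complex.

Set Implicit Arguments.
Unset Strict Implicit.
Unset Printing Implicit Defensive.

Import Order.TTheory GRing.Theory Num.Theory numFieldNormedType.Exports.
Import ComplexField.Normc.

Local Open Scope classical_set_scope.
Local Open Scope ring_scope.

(* A Dirichlet series sum_{n >= 1} a_n n^{-s} is represented by its coefficient
   sequence a : nat -> R[i]; likewise a weight is a sequence w : nat -> R.  In
   both cases the value at 0 is meaningless and is never used below.

   R[i] carries no topology of its own in the libraries: limits of complex
   sequences are taken in R[i]^o, whose topology is the one of the modulus. *)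

Section DirichletSeries.
Context {R : realType}.

(* n^{-s}, for n >= 1 and s complex *)
Definition npowN (n : nat) (s : R[i]) : R[i] :=
  let t := complex.Im s * ln n%:R in
  (n%:R `^ (- complex.Re s))%:C%C * (cos t -i* sin t)%C.

(* The class D. *)
Definition dirichlet_class (b : nat -> R[i]) : Prop :=
  exists sigma : R, forall s : R[i], sigma < complex.Re s ->
    cvgn (fun N => \sum_(1 <= n < N) b n * npowN n s : R[i]^o).

Definition dirichlet_polynomial (a : nat -> R[i]) : Prop :=
  exists N : nat, forall n : nat, (N < n)%N -> a n = 0.

Definition dirichlet_mul (a b : nat -> R[i]) (n : nat) : R[i] :=
  \sum_(k <- divisors n) a k * b (n %/ k)%N.

Definition num_divisors (n : nat) : nat := size (divisors n).

(* Riemann zeta function at a real s > 1 *)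
Definition zeta (s : R) : R :=
  limn (fun N => \sum_(1 <= n < N) n%:R `^ (- s)).

(* d n = d_gamma(n) for all n >= 1, where zeta(s)^gamma = sum_n d_gamma(n) n^{-s}.
   The identity is imposed for real s > 1 only, where zeta(s) > 0 and the power
   is unambiguous; this already determines the coefficients. *)
Definition zeta_power_coef (gamma : R) (d : nat -> R) : Prop :=
  forall s : R, 1 < s ->
    (fun N => \sum_(1 <= n < N) d n * n%:R `^ (- s)) @ \oo
      --> zeta s `^ gamma.

(* The class W. *)
Definition weight_class (w : nat -> R) : Prop :=
  exists2 beta : R, 0 < beta &
    (forall n : nat, (0 < n)%N -> w n = (num_divisors n)%:R `^ beta)
    \/ zeta_power_coef (beta + 1) w.

Definition H2w_normsq (w : nat -> R) (a : nat -> R[i]) : \bar R :=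
  (\sum_(1 <= n <oo) (normc (a n) ^+ 2 / w n)%:E)%E.

Definition in_H2w (w : nat -> R) (a : nat -> R[i]) : Prop :=
  (H2w_normsq w a < +oo)%E.

Definition H2w_norm (w : nat -> R) (a : nat -> R[i]) : R :=
  Num.sqrt (fine (H2w_normsq w a)).

Definition H2w_inner (w : nat -> R) (a b : nat -> R[i]) : R[i] :=
  limn (fun N => \sum_(1 <= n < N) a n * (b n)^*%C / (w n)%:C%C : R[i]^o).

(* T_g f(s) = - int_s^{+oo} f(u) g'(u) du on coefficients, since
   g'(s) = - sum_n b_n (log n) n^{-s} and int_s^{+oo} n^{-u} du = n^{-s} / log n
   for n >= 2.  The value at n = 1 is an empty sum. *)
Definition volterra (g f : nat -> R[i]) (n : nat) : R[i] :=
  ((ln n%:R : R)^-1)%:C%C *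
  \sum_(k <- divisors n | (k < n)%N)
    f k * g (n %/ k)%N * (ln (n %/ k)%:R)%:C%C.

Definition volterra_bounded (w : nat -> R) (g : nat -> R[i]) : Prop :=
  exists C : R, forall f : nat -> R[i], in_H2w w f ->
    in_H2w w (volterra g f) /\
    H2w_norm w (volterra g f) <= C * H2w_norm w f.

Definition hankel (w : nat -> R) (g : nat -> R[i]) (F : nat -> R[i]) : R[i] :=
  H2w_inner w F g.

Definition hankel_bounded (w : nat -> R) (g : nat -> R[i]) : Prop :=
  exists C : R, forall f h : nat -> R[i],
    dirichlet_polynomial f -> dirichlet_polynomial h ->
    normc (hankel w g (dirichlet_mul f h))
      <= C * H2w_norm w f * H2w_norm w h.

End DirichletSeries.

(* Main.v *)
Require Import Defs.
From mathcomp Require Import all_boot all_order all_algebra.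
From mathcomp Require Import all_classical all_reals all_analysis.
From mathcomp Require Import complex ring lra zify.

(** Write [D] for the multiplication of the [n]-th coefficient by [log n], and put
[v n = 1 / (w n * (log n)^2)]. The product rule [D(fh) = (Df)h + f(Dh)] turns
[<fh, g>], up to its constant term, into [L(f,h) + L(h,f)] where
[L(f,h) = sum_n v n * ((Df)h)_n * conj((Dg)_n)], while the squared norm of
[T_g h] is [sum_n v n * |(h(Dg))_n|^2] and that of [Df], in the same weight, is
at most the one of [f]. So the theorem follows from the
inequality [|<Fh, G>_v| <= |F|_v * |hG|_v] for [F = Df] and [G = Dg], that is
from the hyponormality of multiplication by [h] in the space of weight [v]
([moment_hyponormal]).

If [v n] is the integral of [|z^n|^2] against a measure on completely
multiplicative functions [z], invariant under rotation of the values at the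
primes, the inequality is Cauchy-Schwarz: [<Fh, G>_v] is the integral of
[F * conj(conj(h) G)], and [|conj(h) G| = |h G|] pointwise. Instead of
constructing the measure, one expands the integral of [|conj(h) G - F|^2] into
a finite sum over quadruples with [k' l = k l'], in which only the moments
[v (k' l)] occur. Grouping the pairs [(k,l)] by the ratio [k / l = b / a] in
lowest terms, the sum is nonnegative as soon as the matrices [v (a b m m')],
indexed by [m] and [m'], are positive semidefinite.

For [v] this is proved with a single positive kernel, the Cauchy kernel
[1 / (x + y)], and the stability of positivity under entrywise products and
limits. The factor [1 / (log n)^2] is its square, as [log (c m m')] is a sum of
a term in [m] and a term in [m'] ([moment_log_weight]). The factor [1 / w] is a
product over the primes of kernels [rho (e + i + j)] in the exponents. For
[w = d_(beta+1)], [rho k = k! Gamma(beta+1) / Gamma(k+beta+1)] is an infinite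
product of factors [1 + beta / (n + k)] ([schur_gratio]); for [w = d^beta],
[rho k = (k+1)^(-beta)] is a limit of rescalings of the former
([schur_inv_power]). That the coefficients of [zeta^(beta+1)] are given by
their Euler product ([zeta_power_coefE]) follows from the uniqueness of
Dirichlet coefficients and the fact that these products form a monotone
semigroup in the exponent, by the Vandermonde identity.

Since [T_g 1 = g - g_1], the symbol lies in the space, and the inequality for
finitely supported sequences can be applied to a truncation of it. *)

Set Implicit Arguments.
Unset Strict Implicit.
Unset Printing Implicit Defensive.

Import Order.TTheory GRing.Theory Num.Theory numFieldNormedType.Exports.
Import ComplexField.Normc.

Local Open Scope classical_set_scope.
Local Open Scope ring_scope.

(** * Positive semidefinite kernels and Schur multipliers *)

Section PositiveKernels.
Context {R : realType}.
Implicit Types (K L : nat -> nat -> R).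

(** Real coefficients, since every kernel below is real; complex coefficients
follow by splitting into real and imaginary parts. *)
Definition psd K := forall s : seq (R * nat),
  0 <= \sum_(p <- s) \sum_(q <- s) p.1 * q.1 * K p.2 q.2.

(** Multipliers for entrywise products. By the Schur product theorem these are
the positive semidefinite kernels again, but this form of the condition makes
closure under products and pointwise limits immediate, and no factorization of
a general positive semidefinite kernel is ever required. *)
Definition schur K := forall L, psd L -> psd (fun i j => K i j * L i j).

Lemma schur_psd K : schur K -> psd K.
Proof.
move=> /(_ (fun _ _ => 1)) sK s.
have {}sK : psd (fun i j => K i j * 1).
  apply: sK => t; have -> : \sum_(p <- t) \sum_(q <- t) p.1 * q.1 * 1 =
    (\sum_(p <- t) p.1) ^+ 2 :> R by
    rewrite expr2 big_distrl; apply: eq_bigr => p _ /=; rewrite big_distrr /=;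
    apply: eq_bigr => q _; rewrite mulr1.
  exact: sqr_ge0.
have := sK s; congr (_ <= _).
by apply: eq_bigr => p _; apply: eq_bigr => q _; rewrite mulr1.
Qed.

Lemma eq_psd K L : K =2 L -> psd K -> psd L.
Proof.
move=> eqK pK s; have := pK s; congr (_ <= _).
by apply: eq_bigr => p _; apply: eq_bigr => q _; rewrite eqK.
Qed.

Lemma eq_schur K L : K =2 L -> schur K -> schur L.
Proof. by move=> eqK sK M pM; apply: eq_psd (sK _ pM) => i j; rewrite eqK. Qed.

Lemma schur_rank1 (u : nat -> R) : schur (fun i j => u i * u j).
Proof.
move=> L pL s; have := pL [seq (p.1 * u p.2, p.2) | p <- s].
congr (_ <= _); rewrite big_map; apply: eq_bigr => p _; rewrite big_map.
by apply: eq_bigr => q _ /=; ring.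
Qed.

Lemma schur_cst (c : R) : 0 <= c -> schur (fun _ _ => c).
Proof.
move=> c0; apply: eq_schur (schur_rank1 (fun=> Num.sqrt c)) => i j /=.
by rewrite -expr2 sqr_sqrtr.
Qed.

Lemma schurD K K' : schur K -> schur K' -> schur (fun i j => K i j + K' i j).
Proof.
move=> sK sK' L pL s; have := addr_ge0 (sK L pL s) (sK' L pL s).
congr (_ <= _); rewrite -big_split; apply: eq_bigr => p _ /=.
by rewrite -big_split; apply: eq_bigr => q _ /=; ring.
Qed.

Lemma schurM K K' : schur K -> schur K' -> schur (fun i j => K i j * K' i j).
Proof.
move=> sK sK' L pL; apply: eq_psd (sK _ (sK' _ pL)) => i j.
by rewrite mulrA.
Qed.

Lemma schur_prod (T : Type) (r : seq T) (P : pred T) (F : T -> nat -> nat -> R) :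
  (forall t, P t -> schur (F t)) ->
  schur (fun i j => \prod_(t <- r | P t) F t i j).
Proof.
move=> sF; elim: r => [|t r IH].
  by apply: eq_schur (schur_cst ler01) => i j; rewrite big_nil.
case: (boolP (P t)) => Pt; last first.
  by apply: eq_schur IH => i j; rewrite big_cons (negPf Pt).
by apply: eq_schur (schurM (sF t Pt) IH) => i j; rewrite big_cons Pt.
Qed.

Lemma schur_lim (F : nat -> nat -> nat -> R) K :
  (forall n, schur (F n)) ->
  (forall i j, (fun n => F n i j) @ \oo --> K i j) -> schur K.
Proof.
move=> sF FK L pL s.
pose S n := \sum_(p <- s) \sum_(q <- s) p.1 * q.1 * (F n p.2 q.2 * L p.2 q.2).
have cS : S @ \oo -->
    \sum_(p <- s) \sum_(q <- s) p.1 * q.1 * (K p.2 q.2 * L p.2 q.2).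
  apply: cvg_big => [|p _]; first exact: add_continuous.
  apply: cvg_big => [|q _]; first exact: add_continuous.
  by apply: cvgMr; apply: cvgMl; apply: FK.
rewrite -(cvg_lim _ cS)//; apply: limr_ge; first by apply/cvg_ex; eexists; exact: cS.
by apply: nearW => n; apply: sF.
Qed.

(** One elimination step: subtracting from the Cauchy matrix the rank one matrix
[2 a / ((x + a) (y + a))] leaves the Cauchy matrix rescaled by
[(x - a) / (x + a)] on both sides, with vanishing row and column at [a]. *)
Lemma cauchy_gram (s : seq R) : all (fun x => 0 < x) s ->
  exists us : seq (R -> R), forall x y, x \in s -> y \in s ->
    (x + y)^-1 = \sum_(u <- us) u x * u y.
Proof.
elim: s => [|a s IH] /=; first by exists [::].
case/andP=> a0 /[dup] /allP s0 /IH [us Hus].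
exists ((fun x => Num.sqrt (2 * a) / (x + a)) ::
        [seq (fun x => (x - a) / (x + a) * u x) | u <- us]) => x y xs ys.
have x0 : 0 < x by move: xs; rewrite inE => /predU1P[->//|/s0].
have y0 : 0 < y by move: ys; rewrite inE => /predU1P[->//|/s0].
have xa : x + a != 0 by rewrite gt_eqF// addr_gt0.
have ya : y + a != 0 by rewrite gt_eqF// addr_gt0.
have xy : x + y != 0 by rewrite gt_eqF// addr_gt0.
rewrite big_cons big_map.
have -> : \sum_(u <- us) (x - a) / (x + a) * u x * ((y - a) / (y + a) * u y) =
   (x - a) / (x + a) * ((y - a) / (y + a)) * \sum_(u <- us) u x * u y.
  by rewrite big_distrr; apply: eq_bigr => u _ /=; ring.
have -> : Num.sqrt (2 * a) / (x + a) * (Num.sqrt (2 * a) / (y + a)) =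
   2 * a / (x + a) / (y + a).
  have : Num.sqrt (2 * a) * Num.sqrt (2 * a) = 2 * a.
    by rewrite -expr2 sqr_sqrtr// mulr_ge0// ltW.
  by move: (Num.sqrt _) => r <-; field; rewrite xa ya.
have E : 2 * a / (x + a) / (y + a) +
   (x - a) / (x + a) * ((y - a) / (y + a)) * (x + y)^-1 = (x + y)^-1.
  by field; rewrite xa ya xy.
move: xs ys; rewrite !inE => /predU1P[xa0|xs] /predU1P[ya0|ys]; first 3 last.
- by rewrite -(Hus x y)// E.
- by rewrite -E xa0 subrr !mul0r.
- by rewrite -E xa0 subrr !mul0r.
- by rewrite -E ya0 subrr !(mul0r, mulr0).
Qed.

(** All the positivity below comes from this kernel. *)
Lemma schur_cauchy (x : nat -> R) : (forall i, 0 < x i) ->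
  schur (fun i j => (x i + x j)^-1).
Proof.
move=> x0 L pL s.
have [|us Hus] := @cauchy_gram [seq x p.2 | p <- s].
  by apply/allP => y /mapP[p _ ->].
have : 0 <= \sum_(u <- us) \sum_(p <- s) \sum_(q <- s)
     p.1 * q.1 * (u (x p.2) * u (x q.2) * L p.2 q.2).
  by apply: sumr_ge0 => u _; apply: (@schur_rank1 (u \o x)).
congr (_ <= _); rewrite exchange_big; apply: eq_big_seq => p ps /=.
rewrite exchange_big; apply: eq_big_seq => q qs /=.
rewrite Hus; [|exact: (map_f (fun p => x p.2))..].
by rewrite big_distrl big_distrr.
Qed.

End PositiveKernels.

(** * Beta moments and negative powers as Hankel kernels *)

Section GammaRatio.
Context {R : realType}.
Variable beta : R.
Hypothesis beta0 : 0 < beta.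

(** The Beta moments [k! Gamma(beta+1) / Gamma(k+beta+1)]; their inverses are
the values of [d_(beta+1)] at the powers of a prime. *)
Definition gratio (k : nat) : R := \prod_(i < k) (i.+1%:R / (i.+1%:R + beta)).

Lemma gratio0 : gratio 0 = 1. Proof. exact: big_ord0. Qed.

Lemma gratioS k : gratio k.+1 = gratio k * (k.+1%:R / (k.+1%:R + beta)).
Proof. exact: big_ord_recr. Qed.

Let natD_gt0 (k : nat) : 0 < k.+1%:R + beta.
Proof. by rewrite ltr_wpDl. Qed.

Lemma gratio_gt0 k : 0 < gratio k.
Proof. by apply: prodr_gt0 => i _; rewrite divr_gt0. Qed.

Lemma gratio_le k : gratio k.+1 <= gratio k.
Proof.
rewrite gratioS ler_piMr ?(ltW (gratio_gt0 _))// ler_pdivrMr// mul1r.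
by rewrite lerDl ltW.
Qed.

(* A truncated Euler product for the Gamma quotient. It is symmetric in N and k,
   which is why it can be evaluated in closed form. *)
Let gprod (N k : nat) : R :=
  \prod_(n < N) (n.+1%:R / (n.+1%:R + beta) * (1 + beta / (n.+1 + k)%:R)).

Let gprodS N k : gprod N k.+1 =
  gprod N k * (k.+1%:R / (k.+1%:R + beta) * (1 + beta / (N + k.+1)%:R)).
Proof.
elim: N => [|N IH].
  rewrite /gprod !big_ord0 mul1r add0n.
  have := natD_gt0 k; have := ler0n R k; rewrite !mulrS => n0 b0.
  by field; rewrite !gt_eqF//; lra.
rewrite /gprod big_ord_recr /= -/(gprod _ _) {}IH big_ord_recr /= -/(gprod _ _).
have := natD_gt0 k; have := natD_gt0 N; have := natD_gt0 (N + k).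
have : 0 <= k%:R :> R by []. have : 0 <= N%:R :> R by [].
have := beta0; rewrite !(natrD, mulrS) => b0 N0 k0 A B C.
by field; rewrite !gt_eqF//; lra.
Qed.

Lemma gratio_prod (N k : nat) :
  gprod N k = gratio k * \prod_(i < k) (1 + beta / (N + i.+1)%:R).
Proof.
elim: k => [|k IH].
  rewrite /gprod gratio0 !big_ord0 mul1r big1// => n _; rewrite addn0.
  have := natD_gt0 n; have := ler0n R n; rewrite !mulrS => n0 b0.
  by field; rewrite !gt_eqF//; lra.
by rewrite gprodS IH gratioS big_ord_recr /=; ring.
Qed.

Lemma gratio_lim k : gprod^~ k @ \oo --> gratio k.
Proof.
have harm i : (fun N => beta / (N + i.+1)%:R) @ \oo --> (0 : R).
  rewrite -(mulr0 beta); apply: cvgMr.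
  have := @cvg_harmonic R; rewrite -(cvg_shiftn i); apply: cvg_trans.
  by apply: near_eq_cvg; apply: nearW => n /=; rewrite addnS.
have : (fun N => gratio k * \prod_(i < k) (1 + beta / (N + i.+1)%:R)) @ \oo
    --> gratio k * \prod_(i < k) (1 + 0).
  apply: cvgMr; apply: cvg_big => [|i _]; first exact: mul_continuous.
  by apply: cvgD; [exact: cvg_cst|exact: harm].
under eq_fun do rewrite -gratio_prod.
by rewrite big1 ?mulr1// => i _; rewrite addr0.
Qed.

(** Each factor of the product is [1 + beta / (n + k)] up to a positive
constant, that is a constant plus a Cauchy kernel when [k = e + a i + a j]. *)
Lemma schur_gratio (e : nat) (a : nat -> nat) :
  schur (fun i j => gratio (e + a i + a j)).
Proof.
apply: (schur_lim (F := fun N i j => gprod N (e + a i + a j))); last first.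
  by move=> i j; exact: gratio_lim.
move=> N; apply: schur_prod => n _.
apply: schurM; first by apply: schur_cst; rewrite divr_ge0// ltW.
apply: schurD; first exact: schur_cst.
apply: schurM; first by apply: schur_cst; rewrite ltW.
have x0 i : 0 < (n.+1 + e)%:R / 2 + (a i)%:R :> R.
  by rewrite ltr_wpDr// divr_gt0.
apply: eq_schur (schur_cauchy x0) => i j; congr (_^-1).
by rewrite !natrD !mulrS; field.
Qed.

(* The two bounds on (y + 1)^beta / y^beta make j^beta * gratio j increasing and
   (j + 1 + beta)^beta * gratio j decreasing. *)
Let powR_succ_ge (y : R) : 0 < y ->
  y `^ beta * expR (beta / (y + 1)) <= (y + 1) `^ beta.
Proof.
move=> y0; have y1 : 0 < y + 1 by rewrite addr_gt0.
rewrite /powR !gt_eqF// -expRD ler_expR -mulrDr ler_pM2l//.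
rewrite -lerBrDl -lerN2 opprB -ln_div ?posrE//.
have -> : y / (y + 1) = 1 + (- (y + 1)^-1) by field; rewrite gt_eqF.
by apply: le_ln1Dx; rewrite ltrN2 invf_lt1// ltrDr.
Qed.

Let powR_succ_le (y : R) : 0 < y ->
  (y + 1) `^ beta <= y `^ beta * expR (beta / y).
Proof.
move=> y0; have y1 : 0 < y + 1 by rewrite addr_gt0.
rewrite /powR !gt_eqF// -expRD ler_expR -mulrDr ler_pM2l//.
rewrite -lerBlDl -ln_div ?posrE//.
have -> : (y + 1) / y = 1 + y^-1 by field; rewrite gt_eqF.
by apply: le_ln1Dx; rewrite (@lt_trans _ _ 0)// ?ltrN10// invr_gt0.
Qed.

Let u (j : nat) : R := j%:R `^ beta * gratio j.

Let u_nd : {homo u : m n / (m <= n)%N >-> m <= n}.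
Proof.
apply/nondecreasing_seqP => -[|j].
  by rewrite /u powR0 ?gt_eqF// mul0r mulr_ge0// ?powR_ge0// ltW// gratio_gt0.
have j1 : 0 < j.+1%:R :> R by [].
rewrite /u (gratioS j.+1) mulrCA [leLHS]mulrC ler_pM2l ?gratio_gt0//.
rewrite mulrA ler_pdivlMr// -(natr1 j.+1).
have j2 : 0 <= j.+1%:R + 1 :> R by rewrite natr1.
apply: le_trans (ler_wpM2r j2 (powR_succ_ge j1)).
rewrite -mulrA ler_wpM2l ?powR_ge0//.
have := ler_wpM2r j2 (expR_ge1Dx (beta / (j.+1%:R + 1))).
by rewrite mulrDl mul1r divfK ?natr1// gt_eqF.
Qed.

Let v (j : nat) : R := (j.+1%:R + beta) `^ beta * gratio j.

Let v_ni j : v j <= v 0.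
Proof.
elim: j => // j; apply: le_trans; have y0 := natD_gt0 j.
rewrite /v gratioS mulrCA [leRHS]mulrC ler_pM2l ?gratio_gt0//.
rewrite mulrA ler_pdivrMr//.
have -> : j.+2%:R + beta = (j.+1%:R + beta) + 1 by rewrite -(natr1 j.+1) addrAC.
apply: le_trans (ler_wpM2r (ler0n _ _) (powR_succ_le y0)) _.
rewrite -mulrA ler_wpM2l ?powR_ge0//.
have := expR_ge1Dx (- (beta / (j.+1%:R + beta))).
rewrite expRN => /(ler_wpM2l (expR_ge0 (beta / (j.+1%:R + beta)))).
rewrite divff ?gt_eqF ?expR_gt0// => /(ler_wpM2r (ltW y0)).
rewrite mul1r -mulrA mulrDl mul1r mulNr divfK ?gt_eqF//.
by rewrite addrK.
Qed.

Let u_cvg : cvgn u /\ 0 < limn u.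
Proof.
have cu : cvgn u.
  apply: nondecreasing_is_cvgn => //; exists (v 0) => _ [j _ <-].
  apply: le_trans (v_ni j); rewrite ler_wpM2r ?(ltW (gratio_gt0 _))//.
  have jle : j%:R <= j.+1%:R + beta :> R.
    by apply: (@le_trans _ _ j.+1%:R); rewrite ?ler_nat// lerDl ltW.
  by apply: ge0_ler_powR; rewrite ?nnegrE ?(ltW beta0) ?(ltW (natD_gt0 _)).
split=> //; apply: lt_le_trans (nondecreasing_cvgn_le u_nd cu 1).
by rewrite mulr_gt0 ?powR_gt0 ?gratio_gt0.
Qed.

(** Since [j^beta * gratio j] is increasing and bounded, it has a positive limit,
which cancels in the quotient. *)
Lemma gratio_power (M : nat) : (0 < M)%N ->
  (fun N => gratio (N * M) / gratio N) @ \oo --> M%:R `^ (- beta).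
Proof.
move=> M0; have [cu l0] := u_cvg.
have cuM : (fun N => u (N * M)) @ \oo --> limn u.
  by apply: (cvg_comp _ _ (cvg_mulnr M M0) cu).
have : (fun N => u (N * M) / u N * M%:R `^ (- beta)) @ \oo -->
    limn u / limn u * M%:R `^ (- beta).
  by apply: cvgMl; apply: cvgM => //; apply: cvgV => //; rewrite gt_eqF.
rewrite divff ?gt_eqF// mul1r; apply: cvg_trans; apply: near_eq_cvg.
exists 1%N => // N /= N0; rewrite /u natrM powRM// powRN.
have := gratio_gt0 N; have N0' : 0 < N%:R :> R by rewrite ltr0n.
have M0' : 0 < M%:R :> R by rewrite ltr0n.
have := powR_gt0 beta N0'; have := powR_gt0 beta M0' => A B C.
by field; rewrite !gt_eqF.
Qed.

(** The kernels [gratio (N (e + a i + a j + 1))] have the form treated in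
[schur_gratio], so the power is a limit of multipliers. *)
Lemma schur_inv_power (e : nat) (a : nat -> nat) :
  schur (fun i j => (e + a i + a j).+1%:R `^ (- beta)).
Proof.
apply: (schur_lim (F := fun N i j => gratio (N * (e + a i + a j).+1) / gratio N));
  last by move=> i j; exact: gratio_power.
move=> N; apply: schurM; last by apply: schur_cst; rewrite invr_ge0 ltW// gratio_gt0.
apply: eq_schur (schur_gratio (N * e.+1) (fun i => N * a i)%N) => i j.
by congr gratio; lia.
Qed.

End GammaRatio.

(** * Dirichlet convolution and multiplicative functions *)

Section Arithmetic.

(** Induction over the factorization, one prime power at a time. *)
Lemma coprime_part_ind (P : nat -> Prop) :
  P 1%N ->
  (forall p k m, prime p -> ~~ (p %| m)%N -> (0 < m)%N -> P m ->
     P (p ^ k.+1 * m)%N) ->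
  forall n, (0 < n)%N -> P n.
Proof.
move=> P1 PM n; elim/ltn_ind: n => n IH n0.
case: (leqP n 1) => [|n1]; first by case: n n0 {IH} => [|[|]].
have pr := pdiv_prime n1; set p := pdiv n in pr.
have [m pm en] := pfactor_coprime pr n0.
have lp : (0 < logn p n)%N by rewrite logn_gt0 mem_primes pr n0 pdiv_dvd.
have m0 : (0 < m)%N by move: n0; rewrite en muln_gt0 => /andP[].
rewrite en mulnC -(prednK lp); apply: PM => //.
  by rewrite -prime_coprime.
apply: IH => //; rewrite [X in (_ < X)%N]en ltn_Pmulr//.
by rewrite -(exp1n (logn p n)) ltn_exp2r// prime_gt1.
Qed.

Lemma perm_divisors_coprime (p k m : nat) :
  prime p -> ~~ (p %| m)%N -> (0 < m)%N ->
  perm_eq (divisors (p ^ k * m)%N)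
          [seq (p ^ i * d)%N | i <- iota 0 k.+1, d <- divisors m].
Proof.
move=> pr pm m0; have p0 := prime_gt0 pr.
have n0 : (0 < p ^ k * m)%N by rewrite muln_gt0 expn_gt0 p0.
have lpd d : d \in divisors m -> logn p d = 0%N /\ (0 < d)%N.
  rewrite -dvdn_divisors// => dm; have d0 := dvdn_gt0 m0 dm; split=> //.
  apply: logn_coprime; rewrite prime_coprime//; apply: contra pm => pd.
  exact: dvdn_trans dm.
apply: uniq_perm; first exact: divisors_uniq.
  apply: allpairs_uniq; rewrite ?iota_uniq ?divisors_uniq//.
  move=> [i d] [j e] st1 st2 /= E.
  have dm : d \in divisors m by case/allpairsP: st1 => -[? ?] [_ ? [_ ->]].
  have em : e \in divisors m by case/allpairsP: st2 => -[? ?] [_ ? [_ ->]].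
  have [ld d0] := lpd _ dm; have [le e0] := lpd _ em.
  have := congr1 (logn p) E; rewrite !lognM ?expn_gt0 ?p0//.
  rewrite !pfactorK// ld le !addn0 => ij; move: E; rewrite ij.
  by move/eqP; rewrite eqn_pmul2l ?expn_gt0 ?p0// => /eqP ->.
move=> n; rewrite -dvdn_divisors//; apply/idP/idP => [nd|/allpairsP].
  apply/allpairsP; have nn0 := dvdn_gt0 n0 nd.
  have [d pd en] := pfactor_coprime pr nn0.
  exists (logn p n, d); split; last by rewrite mulnC.
    rewrite mem_iota add0n ltnS /=.
    have := dvdn_leq_log p n0 nd.
    rewrite lognM ?expn_gt0 ?p0// pfactorK// (@logn_coprime p m) ?addn0//.
    by rewrite prime_coprime.
  rewrite -dvdn_divisors//= -(@Gauss_dvdr d (p ^ k)).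
    by apply: dvdn_trans nd; rewrite en dvdn_mulr.
  by rewrite coprime_sym coprimeXl.
move=> [[i d] [ik /= dm ->]]; apply: dvdn_mul; last by rewrite dvdn_divisors.
by apply: dvdn_exp2l; move: ik; rewrite mem_iota add0n ltnS.
Qed.

Lemma num_divisors_coprime (p k m : nat) :
  prime p -> ~~ (p %| m)%N -> (0 < m)%N ->
  num_divisors (p ^ k * m) = (k.+1 * num_divisors m)%N.
Proof.
move=> pr pm m0; rewrite /num_divisors (perm_size (perm_divisors_coprime k pr pm m0)).
by rewrite size_allpairs size_iota.
Qed.

End Arithmetic.

Section DirichletConvolution.
Context {S : comNzRingType}.
Implicit Types a b : nat -> S.

(** The product of Dirichlet series over any commutative ring, needed both for
real weights and for complex coefficients. *)
Definition dconv a b (n : nat) : S :=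
  \sum_(k <- divisors n) a k * b (n %/ k)%N.

Lemma dconv_dvdE a b (n B : nat) : (0 < n < B)%N ->
  dconv a b n = \sum_(1 <= k < B | (k %| n)%N) a k * b (n %/ k)%N.
Proof.
case/andP=> n0 nB; rewrite -big_filter; apply: perm_big; apply: uniq_perm.
- exact: divisors_uniq.
- by rewrite filter_uniq ?iota_uniq.
move=> k; rewrite -dvdn_divisors// mem_filter mem_index_iota.
case kn: (k %| n)%N => //=; rewrite (dvdn_gt0 n0 kn)/=.
by rewrite (leq_ltn_trans (dvdn_leq n0 kn)).
Qed.

Lemma dconvE a b (n B : nat) : (0 < n < B)%N ->
  dconv a b n =
    \sum_(1 <= k < B) \sum_(1 <= l < B | (k * l == n)%N) a k * b l.
Proof.
move=> nB; rewrite (dconv_dvdE _ _ nB); case/andP: nB => n0 nB.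
rewrite big_mkcond; apply: eq_bigr => k _; case: ifP => kn; last first.
  by rewrite big1// => l /eqP kl; rewrite -kl dvdn_mulr in kn.
have k0 := dvdn_gt0 n0 kn.
have nk : ((1 <= n %/ k) && (n %/ k < B))%N.
  by rewrite divn_gt0// dvdn_leq//= (leq_ltn_trans (leq_div _ _)).
rewrite (big_rem (n %/ k)%N) ?mem_index_iota//= mulnC divnK// eqxx.
rewrite big1_seq ?addr0// => l /andP[/eqP <-]; rewrite mulKn//.
by rewrite mem_rem_uniq ?iota_uniq// inE eqxx.
Qed.

(** Summation over pairs, with one common range for both factors: this gives
finite expansions and also comparisons of partial sums. *)
Lemma sum_dconv a b (phi : nat -> S) (M B : nat) : (M <= B)%N ->
  \sum_(1 <= n < M) phi n * dconv a b n =
  \sum_(1 <= k < B) \sum_(1 <= l < B | (k * l < M)%N) phi (k * l)%N * (a k * b l).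
Proof.
move=> MB; transitivity (\sum_(1 <= n < M) \sum_(1 <= k < B)
    \sum_(1 <= l < B | (k * l == n)%N) phi n * (a k * b l)).
  apply: eq_big_nat => n /andP[n0 nM]; rewrite (@dconvE _ _ _ B); last first.
    by rewrite n0 (leq_trans nM).
  by rewrite big_distrr; apply: eq_bigr => k _; rewrite /= big_distrr.
rewrite exchange_big; apply: eq_big_nat => k /andP[k0 _] /=.
rewrite (exchange_big_dep xpredT)//= [RHS]big_mkcond.
apply: eq_big_nat => l /andP[l0 _].
case: ifPn => klM; last first.
  rewrite big_nat_cond big1// => n /andP[/andP[_ nM] /eqP kl].
  by case/negP: klM; rewrite kl.
rewrite (big_rem (k * l)%N) ?mem_index_iota ?muln_gt0 ?k0 ?l0 ?klM//= eqxx.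
rewrite big1_seq ?addr0// => n /andP[/eqP <-]; rewrite mem_rem_uniq ?iota_uniq//.
by rewrite inE eqxx.
Qed.

Lemma dconvC a b n : (0 < n)%N -> dconv a b n = dconv b a n.
Proof.
case: n => // n _; rewrite !(@dconvE _ _ _ n.+2) ?ltnSn// (exchange_big_dep xpredT)//=.
apply: eq_bigr => k _; apply: eq_big => [l|l _]; first by rewrite mulnC.
by rewrite mulrC.
Qed.

Lemma big_nat_supp (F : nat -> S) (P : pred nat) (N M : nat) : (N <= M)%N ->
  (forall n, (N <= n)%N -> F n = 0) ->
  \sum_(1 <= n < M | P n) F n = \sum_(1 <= n < N | P n) F n.
Proof.
move=> NM F0; case: N NM F0 => [|N] NM F0.
  by rewrite [RHS]big_geq// big1// => n _; exact: F0.
rewrite big_mkcond (@big_cat_nat _ _ _ N.+1)//= -!big_mkcond.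
rewrite [X in _ + X]big_nat_cond [X in _ + X]big1 ?addr0//.
by move=> n /andP[/andP[Nn _] _]; exact: F0.
Qed.

Lemma dconv_supp a b N n : (0 < n)%N ->
  (forall n, (N <= n)%N -> a n = 0) -> (forall n, (N <= n)%N -> b n = 0) ->
  dconv a b n = \sum_(1 <= k < N) \sum_(1 <= l < N | (k * l == n)%N) a k * b l.
Proof.
move=> n0 a0 b0; rewrite (@dconvE _ _ _ (n.+1 + N)); last first.
  by rewrite n0 leq_addr.
rewrite (@big_nat_supp _ _ N) ?leq_addl//; last first.
  by move=> k Nk; rewrite big1// => l _; rewrite a0// mul0r.
apply: eq_bigr => k _; rewrite (@big_nat_supp _ _ N) ?leq_addl// => l Nl.
by rewrite b0// mulr0.
Qed.

Lemma sum_dconv_supp a b (phi : nat -> S) N :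
  (forall n, (N <= n)%N -> a n = 0) -> (forall n, (N <= n)%N -> b n = 0) ->
  \sum_(1 <= n < N * N) phi n * dconv a b n =
  \sum_(1 <= k < N) \sum_(1 <= l < N) phi (k * l)%N * (a k * b l).
Proof.
move=> a0 b0; case: N a0 b0 => [|N] a0 b0; first by rewrite !big_geq.
have NN : (N.+1 <= N.+1 * N.+1)%N by rewrite leq_pmulr.
rewrite (@sum_dconv _ _ _ _ (N.+1 * N.+1)%N)// (@big_nat_supp _ _ N.+1)//; last first.
  by move=> k Nk; rewrite big1// => l _; rewrite a0// mul0r mulr0.
apply: eq_big_nat => k /andP[_ kN]; rewrite (@big_nat_supp _ _ N.+1)//; last first.
  by move=> l Nl; rewrite b0// !mulr0.
rewrite big_nat_cond [RHS]big_nat_cond; apply: eq_bigl => l.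
by case: (ltnP l N.+1) => lN; rewrite ?andbF// ltn_mul// !andbT.
Qed.

End DirichletConvolution.

Section Multiplicative.
Context {R : realType}.
Implicit Types r : nat -> R.

(** The multiplicative function with value [r k] at the [k]-th power of every
prime. *)
Definition multf r (n : nat) : R := \prod_(p <- primes n) r (logn p n).

Lemma multfE r (n B : nat) : r 0%N = 1 -> (0 < n < B)%N ->
  multf r n = \prod_(0 <= p < B | prime p) r (logn p n).
Proof.
move=> r0 /andP[n0 nB].
rewrite (bigID (fun p => p %| n)%N) /= [X in _ * X]big1 ?mulr1; last first.
  move=> p /andP[pr pn]; rewrite logn_coprime ?prime_coprime//.
rewrite -big_filter; apply: perm_big; apply: uniq_perm.
- exact: primes_uniq.
- by rewrite filter_uniq ?iota_uniq.
move=> p; rewrite mem_primes mem_filter mem_index_iota n0 /=.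
case pr: (prime p) => //=; case pn: (p %| n)%N => //=.
by rewrite (leq_ltn_trans (dvdn_leq n0 pn)).
Qed.

Lemma multf1 r : multf r 1 = 1.
Proof. by rewrite /multf big_nil. Qed.

Lemma multf_coprime r (p k m : nat) : r 0%N = 1 ->
  prime p -> ~~ (p %| m)%N -> (0 < m)%N ->
  multf r (p ^ k * m) = r k * multf r m.
Proof.
move=> r0 pr pm m0; have p0 := prime_gt0 pr.
have n0 : (0 < p ^ k * m)%N by rewrite muln_gt0 expn_gt0 p0.
pose B := (p + p ^ k * m).+1.
have mB : (m < B)%N.
  by rewrite ltnS (leq_trans _ (leq_addl _ _))// leq_pmull// expn_gt0 p0.
rewrite (@multfE _ _ B) ?n0 ?ltnS ?leq_addl// (@multfE _ m B) ?m0//.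
have lpm : logn p m = 0%N by apply: logn_coprime; rewrite prime_coprime.
have pB : p \in index_iota 0 B by rewrite mem_index_iota ltnS leq_addr.
have : uniq (index_iota 0 B) by exact: iota_uniq.
move: (index_iota 0 B) pB => s pB us.
rewrite !(big_rem p pB) /= pr lognM ?expn_gt0 ?p0// pfactorK// lpm addn0 r0 mul1r.
congr (_ * _); rewrite big_seq_cond [RHS]big_seq_cond; apply: eq_bigr => q.
rewrite mem_rem_uniq// inE => /andP[/andP[/= qp _] qr].
rewrite lognM ?expn_gt0 ?p0// lognX [logn q p]logn_coprime ?muln0//.
by rewrite prime_coprime// dvdn_prime2.
Qed.

(** A product over the primes of kernels in the exponents; the infinite product
is a limit of finite ones, eventually constant at each entry. *)
Lemma schur_multf r (c : nat) (m : nat -> nat) : r 0%N = 1 ->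
  (forall e a, schur (fun i j => r (e + a i + a j)%N)) ->
  (0 < c)%N -> (forall i, 0 < m i)%N ->
  schur (fun i j => multf r (c * m i * m j)).
Proof.
move=> r0 sr c0 m0.
apply: (schur_lim (F := fun B i j => \prod_(0 <= p < B | prime p)
    r (logn p c + logn p (m i) + logn p (m j))%N)).
  by move=> B; apply: schur_prod => p _; apply: sr.
move=> i j; apply: cvg_near_cst; exists (c * m i * m j).+1 => // B /= nB.
rewrite (@multfE _ _ B) ?nB ?andbT ?muln_gt0 ?c0 ?m0//.
by apply: eq_bigr => p _; rewrite !lognM ?muln_gt0 ?c0 ?m0.
Qed.

Lemma multf_ge0 r n : (forall k, 0 <= r k) -> 0 <= multf r n.
Proof. by move=> r0; apply: prodr_ge0. Qed.

Lemma multf_gt0 r n : (forall k, 0 < r k) -> 0 < multf r n.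
Proof. by move=> r0; apply: prodr_gt0. Qed.

Lemma multf_mull_le r (k l : nat) : r 0%N = 1 -> (forall k, 0 < r k) ->
  (forall k, r k.+1 <= r k) -> (0 < k)%N -> (0 < l)%N ->
  multf r (k * l) <= multf r l.
Proof.
move=> r0 rgt0 rle k0 l0; pose B := (k * l).+1.
have lB : (l < B)%N by rewrite ltnS leq_pmull.
rewrite (@multfE _ _ B) ?muln_gt0 ?k0 ?l0 ?ltnSn// (@multfE _ l B) ?l0//.
apply: ler_prod => p _; rewrite ltW//= lognM// addnC.
elim: (logn p k) => [|e IH]; first by rewrite addn0.
by rewrite addnS (le_trans (rle _)).
Qed.

Lemma dconv_multf r r' n : r 0%N = 1 -> r' 0%N = 1 -> (0 < n)%N ->
  dconv (multf r) (multf r') n =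
  multf (fun k => \sum_(i < k.+1) r i * r' (k - i)%N) n.
Proof.
move=> r0 r0'; move: n; apply: coprime_part_ind.
  by rewrite multf1 /dconv /= big_seq1 !multf1 mulr1.
move=> p k m pr pm m0 IH; have p0 := prime_gt0 pr.
rewrite multf_coprime//; last by rewrite big_ord1 r0 r0' mulr1.
rewrite -{}IH /dconv (perm_big _ (perm_divisors_coprime k.+1 pr pm m0)).
rewrite big_allpairs_dep -(big_mkord xpredT (fun i => r i * r' (k.+1 - i)%N)).
rewrite /index_iota subn0 big_distrl; apply: eq_big_seq => i.
rewrite mem_iota add0n ltnS => /andP[_ ik] /=; rewrite big_distrr.
apply: eq_big_seq => d; rewrite -dvdn_divisors// => dm /=.
have d0 := dvdn_gt0 m0 dm.
have pd : ~~ (p %| d)%N by apply: contra pm => /dvdn_trans; apply.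
have pmd : ~~ (p %| m %/ d)%N.
  by apply: contra pm => h; rewrite -(divnK dm) dvdn_mulr.
have -> : (p ^ k.+1 * m %/ (p ^ i * d) = p ^ (k.+1 - i) * (m %/ d))%N.
  rewrite -{1}(subnKC ik) expnD -{1}(divnK dm) -mulnA.
  rewrite (_ : _ * _ = p ^ (k.+1 - i) * (m %/ d) * (p ^ i * d))%N; last by lia.
  by rewrite mulnK// muln_gt0 expn_gt0 p0.
rewrite !multf_coprime//; first by ring.
by rewrite divn_gt0// dvdn_leq.
Qed.

Lemma eq_multf r r' n : r =1 r' -> multf r n = multf r' n.
Proof. by move=> e; apply: eq_bigr => p _. Qed.

Lemma inv_num_divisors_powR (beta : R) n : (0 < n)%N ->
  ((num_divisors n)%:R `^ beta)^-1 = multf (fun k => k.+1%:R `^ (- beta)) n.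
Proof.
rewrite -powRN; move: n; apply: coprime_part_ind.
  by rewrite multf1 /num_divisors /= powR1.
move=> p k m pr pm m0 IH; rewrite num_divisors_coprime// multf_coprime ?powR1//.
by rewrite -IH natrM powRM.
Qed.

End Multiplicative.

(** * The coefficients of real powers of the zeta function *)

Section RisingBinomial.
Context {R : realType}.
Implicit Types (c d : R).

(** The coefficient of [t^k] in [(1 - t)^(-c)]. *)
Definition rbin c (k : nat) : R := \prod_(i < k) ((c + i%:R) / i.+1%:R).

Lemma rbin0 c : rbin c 0 = 1. Proof. exact: big_ord0. Qed.

Lemma rbinS c k : rbin c k.+1 = rbin c k * ((c + k%:R) / k.+1%:R).
Proof. exact: big_ord_recr. Qed.

Lemma rbin1 k : rbin 1 k = 1.
Proof. by rewrite /rbin big1// => i _; rewrite nat1r divff. Qed.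

Lemma rbin_ge0 c k : 0 <= c -> 0 <= rbin c k.
Proof. by move=> c0; apply: prodr_ge0 => i _; rewrite divr_ge0// addr_ge0. Qed.

Lemma ler_rbin c d k : 0 <= c -> c <= d -> rbin c k <= rbin d k.
Proof.
move=> c0 cd; apply: ler_prod => i _; rewrite divr_ge0 ?addr_ge0//=.
by rewrite ler_wpM2r// lerD2r.
Qed.

(** Both sides satisfy the recursion [(k + 1) s (k + 1) = (c + d + k) s k]: write
[k + 1 = i + (k + 1 - i)] in each term of the convolution. *)
Lemma rbin_vandermonde c d k :
  \sum_(i < k.+1) rbin c i * rbin d (k - i)%N = rbin (c + d) k.
Proof.
elim: k => [|k IH]; first by rewrite big_ord1 !rbin0 mulr1.
have k0 : k.+1%:R != 0 :> R by rewrite pnatr_eq0.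
apply: (mulfI k0); rewrite rbinS -IH.
transitivity (\sum_(i < k.+2) (i%:R * rbin c i) * rbin d (k.+1 - i)%N +
              \sum_(i < k.+2) rbin c i * ((k.+1 - i)%:R * rbin d (k.+1 - i)%N)).
  rewrite -big_split big_distrr; apply: eq_bigr => i _ /=.
  have ik : (i <= k.+1)%N by rewrite -ltnS.
  by rewrite natrB//; ring.
have step e j : j.+1%:R * rbin e j.+1 = (e + j%:R) * rbin e j.
  by rewrite rbinS; field; rewrite addrC natr1 pnatr_eq0.
rewrite big_ord_recl /= mul0r mul0r add0r [X in _ + X]big_ord_recr /= subnn.
rewrite mul0r mulr0 addr0.
under eq_bigr do rewrite /bump /= add1n subSS step.
rewrite -big_split /= [LHS](_ : _ = \sum_(i < k.+1)
    ((c + d) + k%:R) * (rbin c i * rbin d (k - i)%N)).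
  by rewrite -big_distrr /=; field; rewrite addrC natr1 pnatr_eq0.
apply: eq_bigr => i _; have ik : (i <= k)%N by rewrite -ltnS.
by rewrite subSn// step natrB//; ring.
Qed.

Lemma rbin_gratio beta k : 0 < beta -> (gratio beta k)^-1 = rbin (beta + 1) k.
Proof.
move=> b0; elim: k => [|k IH]; first by rewrite gratio0 rbin0 invr1.
rewrite gratioS rbinS -IH invfM invf_div; congr (_ * (_ / _)).
by rewrite -nat1r; ring.
Qed.

Lemma dconv_multf_rbin c d n : (0 < n)%N ->
  dconv (multf (rbin c)) (multf (rbin d)) n = multf (rbin (c + d)) n.
Proof.
move=> n0; rewrite dconv_multf ?rbin0//; apply: eq_multf => k.
exact: rbin_vandermonde.
Qed.

End RisingBinomial.

Section LimitTools.
Context {R : realType}.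

Lemma cvgn_le_cst (u : nat -> R) l c : u @ \oo --> l -> (forall n, u n <= c) -> l <= c.
Proof.
move=> ul uc; rewrite -(cvg_lim _ ul)//.
by apply: limr_le; [apply/cvg_ex; exists l|exact: nearW].
Qed.

Lemma cvgn_ge_cst (u : nat -> R) l c : u @ \oo --> l -> (forall n, c <= u n) -> c <= l.
Proof.
move=> ul uc; rewrite -(cvg_lim _ ul)//.
by apply: limr_ge; [apply/cvg_ex; exists l|exact: nearW].
Qed.

(** Were [b < a], the powers of [a / b] would be unbounded. *)
Lemma ler_of_expr (a b C : R) : 0 <= a -> 0 < b ->
  (forall n, a ^+ n.+1 <= C * b ^+ n.+1) -> a <= b.
Proof.
move=> a0 b0 H; rewrite leNgt; apply/negP => ba.
pose t := a / b - 1; have t0 : 0 < t by rewrite subr_gt0 ltr_pdivlMr// mul1r.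
have tn n : 1 + n.+1%:R * t <= C.
  have : (1 + t) ^+ n.+1 <= C.
    by rewrite addrC subrK expr_div_n ler_pdivrMr ?exprn_gt0.
  apply: le_trans; elim: n => [|n IH]; first by rewrite mul1r expr1.
  rewrite exprSr -natr1; apply: le_trans (ler_wpM2r _ IH); last first.
    by rewrite addr_ge0// ltW.
  have : 0 <= n.+1%:R * t * t by rewrite !mulr_ge0// ltW.
  lra.
have [n nC] : exists n, C < n%:R * t.
  exists (Num.truncn (C / t)).+1; rewrite -ltr_pdivrMr//; exact: truncnS_gt.
by have := tn n; rewrite -natr1 mulrDl mul1r; lra.
Qed.

End LimitTools.

Section DirichletPowers.
Context {R : realType}.
Variable x : nat -> R.
Hypothesis x_ge0 : forall n, 0 <= x n.
Hypothesis xM : forall k l, x (k * l)%N = x k * x l.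
Hypothesis x1 : x 1 = 1.

(** In the application [x n = n^(-K)] for an integer [K > 1]. *)
Definition dsum (a : nat -> R) (N : nat) : R := \sum_(1 <= n < N) a n * x n.

Hypothesis cvg_x : cvgn (dsum (fun=> 1)).

Lemma dsum_nd a : (forall n, 0 <= a n) -> {homo dsum a : m n / (m <= n)%N >-> m <= n}.
Proof.
move=> a0; apply/nondecreasing_seqP => -[|n]; first by rewrite /dsum !big_geq.
by rewrite /dsum [leRHS]big_nat_recr//= lerDl mulr_ge0.
Qed.

Lemma dsum_cvg_le a b : (forall n, 0 <= a n) -> (forall n, a n <= b n) ->
  cvgn (dsum b) -> cvgn (dsum a) /\ limn (dsum a) <= limn (dsum b).
Proof.
move=> a0 ab cb; have b0 n : 0 <= b n by rewrite (le_trans (a0 n)).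
have dab n : dsum a n <= dsum b n.
  by apply: ler_sum => i _; rewrite ler_wpM2r.
have ub n : dsum a n <= limn (dsum b).
  by rewrite (le_trans (dab n))// nondecreasing_cvgn_le//; exact: dsum_nd.
have ca : cvgn (dsum a).
  apply: nondecreasing_is_cvgn; first exact: dsum_nd.
  by exists (limn (dsum b)) => _ [n _ <-].
by split=> //; apply: limr_le => //; exact: nearW.
Qed.

(** For nonnegative terms the product of the [N]-th partial sums lies between
the [N]-th and the [N^2]-th partial sums of the convolution. *)
Lemma dsum_dconv a b : (forall n, 0 <= a n) -> (forall n, 0 <= b n) ->
  cvgn (dsum a) -> cvgn (dsum b) ->
  dsum (dconv a b) @ \oo --> limn (dsum a) * limn (dsum b).
Proof.
move=> a0 b0 ca cb.
have ab0 n : 0 <= dconv a b n by apply: sumr_ge0 => k _; rewrite mulr_ge0.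
have prodE N : dsum a N * dsum b N =
    \sum_(1 <= k < N) \sum_(1 <= l < N) x (k * l)%N * (a k * b l).
  rewrite /dsum big_distrl; apply: eq_bigr => k _ /=; rewrite big_distrr.
  by apply: eq_bigr => l _ /=; rewrite xM; ring.
have convE M B : (M <= B)%N -> dsum (dconv a b) M =
   \sum_(1 <= k < B) \sum_(1 <= l < B | (k * l < M)%N) x (k * l)%N * (a k * b l).
  by move=> MB; rewrite -sum_dconv//; apply: eq_bigr => n _; rewrite mulrC.
have t0 k l : 0 <= x (k * l)%N * (a k * b l) by rewrite !mulr_ge0.
have le1 N : dsum (dconv a b) N <= dsum a N * dsum b N.
  rewrite (convE N N)// prodE; apply: ler_sum => k _.
  by rewrite [leRHS](bigID (fun l => k * l < N)%N) /= lerDl sumr_ge0.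
have le2 N : dsum a N * dsum b N <= dsum (dconv a b) (N * N).
  case: N => [|N]; first by rewrite /dsum !big_geq// mul0r.
  rewrite (convE _ (N.+1 * N.+1)%N)// prodE.
  have NN : (N.+1 <= N.+1 * N.+1)%N by rewrite leq_pmulr.
  rewrite [leRHS](@big_cat_nat _ _ _ N.+1)//= ler_wpDr//.
    by apply: sumr_ge0 => k _; apply: sumr_ge0.
  rewrite big_nat_cond [leRHS]big_nat_cond.
  apply: ler_sum => k /andP[/andP[_ kN] _].
  rewrite [leRHS]big_mkcond [leRHS](@big_cat_nat _ _ _ N.+1)//= ler_wpDr//.
    by apply: sumr_ge0 => l _; case: ifP.
  rewrite big_nat_cond [leRHS]big_nat_cond.
  apply: ler_sum => l /andP[/andP[_ lN] _].
  by rewrite ltn_mul.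
have cp : (fun N => dsum a N * dsum b N) @ \oo --> limn (dsum a) * limn (dsum b).
  exact: cvgM.
have nd := dsum_nd ab0.
have cab : cvgn (dsum (dconv a b)).
  apply: nondecreasing_is_cvgn => //; exists (limn (dsum a) * limn (dsum b)).
  move=> _ [n _ <-]; apply: le_trans (le1 n) _.
  apply: ler_pM; rewrite ?sumr_ge0// => *; rewrite ?mulr_ge0//;
    by rewrite nondecreasing_cvgn_le//; exact: dsum_nd.
suff -> : limn (dsum a) * limn (dsum b) = limn (dsum (dconv a b)) by [].
apply/eqP; rewrite eq_le; apply/andP; split.
  apply: cvgn_le_cst cp _ => n; apply: le_trans (le2 n) _.
  exact: nondecreasing_cvgn_le.
rewrite -(cvg_lim _ cp)//; apply: ler_lim => //.
  by apply/cvg_ex; eexists; exact: cp.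
exact: nearW.
Qed.

(* F c is the sum of the series with coefficients d_c. It is increasing in c,
   and multiplicative by Vandermonde, hence the power F 1 ^ c. *)
Let F c := limn (dsum (multf (rbin c))).

Let D_ge0 (c : R) n : 0 <= c -> 0 <= multf (rbin c) n.
Proof. by move=> c0; apply: multf_ge0 => k; exact: rbin_ge0. Qed.

Let FD c d : 0 <= c -> 0 <= d ->
  cvgn (dsum (multf (rbin c))) -> cvgn (dsum (multf (rbin d))) ->
  dsum (multf (rbin (c + d))) @ \oo --> F c * F d.
Proof.
move=> c0 d0 cc cd.
have := @dsum_dconv (multf (rbin c)) (multf (rbin d)).
move=> /(_ (fun n => D_ge0 n c0) (fun n => D_ge0 n d0) cc cd).
apply: cvg_trans; apply: near_eq_cvg; apply: nearW => N.
by apply: eq_big_nat => n /andP[n0 _]; rewrite dconv_multf_rbin.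
Qed.

Let D1 : multf (rbin (1 : R)) = fun=> 1.
Proof. by apply/funext => n; rewrite /multf big1// => p _; exact: rbin1. Qed.

Let D_cvg c : 0 <= c -> cvgn (dsum (multf (rbin c))).
Proof.
move=> c0; have nat_cvg m : cvgn (dsum (multf (rbin (m.+1%:R : R)))).
  elim: m => [|m IH]; first by rewrite D1.
  rewrite -natr1; apply/cvg_ex; eexists; apply: FD => //.
  by rewrite D1.
have le n : multf (rbin c) n <= multf (rbin (Num.truncn c).+1%:R) n.
  apply: ler_prod => p _; rewrite rbin_ge0//= ler_rbin// ltW//.
  exact: truncnS_gt.
by have [] := dsum_cvg_le (fun n => D_ge0 n c0) le (nat_cvg (Num.truncn c)).
Qed.

Let F_mono c d : 0 <= c -> c <= d -> F c <= F d.
Proof.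
move=> c0 cd; have d0 := le_trans c0 cd.
have le n : multf (rbin c) n <= multf (rbin d) n.
  by apply: ler_prod => p _; rewrite rbin_ge0//= ler_rbin.
by have [] := dsum_cvg_le (fun n => D_ge0 n c0) le (D_cvg d0).
Qed.

Let F_ge1 c : 0 <= c -> 1 <= F c.
Proof.
move=> c0; have nd := dsum_nd (fun n => D_ge0 n c0).
have := nondecreasing_cvgn_le nd (D_cvg c0) 2.
by rewrite /dsum big_nat1 multf1 x1 mulr1.
Qed.

Let FX c n : 0 <= c -> F (n.+1%:R * c) = F c ^+ n.+1.
Proof.
move=> c0; elim: n => [|n IH]; first by rewrite mul1r expr1.
rewrite -natr1 mulrDl mul1r exprSr -IH /F.
apply: cvg_lim => //; apply: FD; rewrite ?mulr_ge0//; apply: D_cvg => //.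
by rewrite mulr_ge0.
Qed.

(** A positive function [F] with [F (c + d) = F c * F d] that is monotone is
exponential: compare [F c ^ n] and [(F 1 `^ c) ^ n] with integer powers of
[F 1]. *)
Lemma dsum_rbin c : 0 < c ->
  dsum (multf (rbin c)) @ \oo --> limn (dsum (fun=> 1)) `^ c.
Proof.
move=> c0; rewrite -D1 -/(F 1).
suff -> : F 1 `^ c = F c by exact: D_cvg (ltW c0).
have Z1 := F_ge1 ler01; set Z := F 1 in Z1 *.
have Z0 : 0 < Z by rewrite (lt_le_trans ltr01).
have Fc0 : 0 < F c by rewrite (lt_le_trans ltr01)// F_ge1// ltW.
have Zc0 : 0 < Z `^ c by rewrite powR_gt0.
(* Both F c ^ n and Z ^ (n c) lie between Z ^ m and Z ^ (m + 1), m = floor (n c). *)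
have FZ m : F m.+1%:R = Z ^+ m.+1 by rewrite -FX// mulr1.
have bnd n : exists m, [/\ Z ^+ m <= F c ^+ n.+1, F c ^+ n.+1 <= Z * Z ^+ m,
    Z ^+ m <= (Z `^ c) ^+ n.+1 & (Z `^ c) ^+ n.+1 <= Z * Z ^+ m].
  have nc0 : 0 <= n.+1%:R * c by rewrite mulr_ge0// ltW.
  have /andP[mle mgt] := truncn_itv nc0; exists (Num.truncn (n.+1%:R * c)).
  move: (Num.truncn _) mle mgt => m mle mgt.
  rewrite -exprS -(FX n (ltW c0)) -!powR_mulrn ?powR_ge0 ?(ltW Z0)//.
  rewrite -powRrM mulrC; split.
  - rewrite powR_mulrn ?(ltW Z0)//; case: m mle {mgt} => [|m] mle.
      by rewrite expr0 F_ge1 // mulrC.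
    by rewrite -FZ F_mono// mulrC.
  - by rewrite powR_mulrn ?(ltW Z0)// -FZ F_mono// 1?mulrC// ltW.
  - by rewrite ler_powR// mulrC.
  - by rewrite ler_powR// mulrC ltW.
apply/eqP; rewrite eq_le; apply/andP; split.
- apply: (@ler_of_expr _ _ _ Z) => // [|n]; first exact: ltW.
  have [m [A _ _ B]] := bnd n; apply: le_trans B _.
  by rewrite ler_wpM2l// ltW.
- apply: (@ler_of_expr _ _ _ Z) => // [|n]; first exact: ltW.
  have [m [_ A B _]] := bnd n; apply: le_trans A _.
  by rewrite ler_wpM2l// ltW.
Qed.

End DirichletPowers.

Section ZetaPower.
Context {R : realType}.

Definition ninv (K n : nat) : R := n%:R^-1 ^+ K.

Lemma sum_inv_sqr (N : nat) : \sum_(1 <= n < N) ninv 2 n <= 2.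
Proof.
case: N => [|[|N]]; try by rewrite big_geq.
have : \sum_(1 <= n < N.+2) ninv 2 n <= 2 - N.+1%:R^-1.
  elim: N => [|N IH].
    by rewrite big_nat1 /ninv invr1 expr1n; lra.
  rewrite big_nat_recr//=; apply: le_trans (lerD IH (lexx _)) _.
  suff : ninv 2 N.+2 <= N.+1%:R^-1 - N.+2%:R^-1.
    by move: (ninv _ _) (N.+1%:R^-1) (N.+2%:R^-1) => u v t; lra.
  have n0 : 0 < N.+1%:R :> R by [].
  rewrite /ninv -(natr1 N.+1); set a := N.+1%:R in n0 *.
  have a1 : 0 < a + 1 by lra.
  rewrite -subr_ge0 [leRHS](_ : _ = (a * (a + 1) ^+ 2)^-1).
    by rewrite invr_ge0 mulr_ge0 ?exprn_ge0// ltW.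
  by field; rewrite !gt_eqF.
by move=> /le_trans; apply; rewrite gerBl invr_ge0.
Qed.

Lemma ninv_le (K n m : nat) : (0 < m <= n)%N -> ninv K n <= ninv K m.
Proof.
case/andP=> m0 mn; rewrite lerXn2r ?nnegrE ?invr_ge0//.
by rewrite lef_pV2 ?posrE ?ltr0n ?(leq_trans m0)// ler_nat.
Qed.

Lemma ninv_cvg K : cvgn (dsum (ninv K.+2) (fun=> 1)).
Proof.
apply: nondecreasing_is_cvgn.
  by apply: dsum_nd => // n; rewrite exprn_ge0// invr_ge0.
exists 2 => _ [N _ <-]; apply: le_trans (sum_inv_sqr N).
apply: ler_sum_nat => n /andP[n0 _]; rewrite mul1r /ninv -(addn2 K) exprD.
rewrite ler_piMl ?exprn_ge0 ?invr_ge0// exprn_ile1 ?invr_ge0//.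
by rewrite invf_le1 ?ltr0n// ler1n.
Qed.

Lemma powR_ninv K n : n%:R `^ (- K%:R) = ninv K n :> R.
Proof. by rewrite powRN powR_mulrn// /ninv exprVn. Qed.

(** If [m] is the first index with a nonzero coefficient, multiplying by [m^s]
isolates that coefficient as [s] tends to infinity. The terms at [s = 2] are
bounded, which dominates the tail at larger integers [s]. *)
Lemma dirichlet_unique (e : nat -> R) :
  (forall K, dsum (ninv K.+2) e @ \oo --> (0 : R)) ->
  forall n, (0 < n)%N -> e n = 0.
Proof.
move=> e0.
have [M M0 eM] : exists2 M, 0 <= M & forall n, (0 < n)%N -> `|e n * ninv 2 n| <= M.
  have [M [_ /(_ (M + 1))]] : bounded_fun (dsum (ninv 2) e).
    by apply: cvg_seq_bounded; apply/cvg_ex; exists 0; exact: e0.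
  rewrite ltrDl ltr01 => /(_ isT) HM.
  have {}HM n : `|dsum (ninv 2) e n| <= M + 1 by exact: HM.
  exists ((M + 1) + (M + 1)).
    by have := le_trans (normr_ge0 _) (HM 0%N) => ?; rewrite addr_ge0.
  move=> n n0.
  have -> : e n * ninv 2 n = dsum (ninv 2) e n.+1 - dsum (ninv 2) e n.
    by rewrite /dsum big_nat_recr//= addrAC subrr add0r.
  by rewrite (le_trans (ler_normB _ _))// lerD.
elim/ltn_ind => m IH m0.
have mR : 0 < m%:R :> R by rewrite ltr0n.
have m1R : 0 < m.+1%:R :> R by [].
have bound K : `|e m| * ninv K.+4 m <= (2 * M) * ninv K m.+1.
  have cv : (fun N => `|dsum (ninv K.+4) e (N + m.+1)|) @ \oo --> (0 : R).
    rewrite -(normr0 R); apply: cvg_norm.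
    by have := e0 K.+2; rewrite -(cvg_shiftn m.+1).
  rewrite -subr_le0.
  suff H : forall N, `|e m| * ninv K.+4 m - (2 * M) * ninv K m.+1 <=
       `|dsum (ninv K.+4) e (N + m.+1)|.
    exact: cvgn_ge_cst cv H.
  move=> N; rewrite /dsum (@big_cat_nat _ _ _ m.+1) ?leq_addl//= big_nat_recr//=.
  rewrite big1_seq ?add0r; last first.
    by move=> k /andP[_]; rewrite mem_index_iota => /andP[k0 km]; rewrite IH// mul0r.
  rewrite lerBlDr; apply: (@le_trans _ _ `|e m * ninv K.+4 m|).
    by rewrite normrM [X in _ <= _ * X]ger0_norm// exprn_ge0// invr_ge0.
  set T := \sum_(_ <= _ < _) _; set E := e m * _.
  have := ler_normB (E + T) T; rewrite addrK => /le_trans; apply.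
  rewrite lerD2l.
  apply: le_trans (ler_norm_sum _ _ _) _.
  rewrite (_ : 2 * M * _ = (M * ninv K m.+1) * 2); last by ring.
  apply: (@le_trans _ _ (\sum_(m.+1 <= n < N + m.+1)
      (M * ninv K m.+1) * ninv 2 n)); last first.
    rewrite -big_distrr /= ler_wpM2l ?mulr_ge0 ?exprn_ge0 ?invr_ge0//.
    apply: le_trans (sum_inv_sqr (N + m.+1)).
    rewrite [leRHS](@big_cat_nat _ _ _ m.+1) ?leq_addl//= lerDr.
    by apply: sumr_ge0 => *; rewrite exprn_ge0 ?invr_ge0.
  apply: ler_sum_nat => n /andP[mn _].
  have -> : e n * ninv K.+4 n = (e n * ninv 2 n) * ninv K n * ninv 2 n.
    by rewrite /ninv; move: (_^-1) => a; rewrite !exprS; ring.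
  rewrite normrM [X in _ * X]ger0_norm ?exprn_ge0 ?invr_ge0//.
  rewrite ler_wpM2r ?exprn_ge0 ?invr_ge0// normrM.
  apply: ler_pM => //; first by apply: eM; apply: leq_trans mn.
  by rewrite ger0_norm ?exprn_ge0 ?invr_ge0// ninv_le.
pose q : R := m%:R / m.+1%:R.
have bq K : `|e m| <= (2 * M * m%:R ^+ 4) * q ^+ K.
  have cancel : ninv K.+4 m * m%:R ^+ K.+4 = 1.
    by rewrite /ninv -exprMn mulVf ?expr1n// gt_eqF.
  have /= := ler_wpM2r (exprn_ge0 K.+4 (ltW mR)) (bound K).
  rewrite -[`|_| * _ * _]mulrA cancel mulr1 => /le_trans; apply.
  rewrite le_eqVlt; apply/orP; left; apply/eqP.
  by rewrite /q expr_div_n /ninv exprVn -(addn4 K) exprD; ring.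
apply/normr0_eq0/eqP; rewrite eq_le normr_ge0 andbT.
have cq : (fun K => (2 * M * m%:R ^+ 4) * q ^+ K) @ \oo --> (0 : R).
  rewrite -[X in _ --> X](mulr0 (2 * M * m%:R ^+ 4)); apply: cvgMr.
  apply: cvg_expr; rewrite ger0_norm ?divr_ge0//.
  by rewrite ltr_pdivrMr// mul1r ltr_nat.
by apply: cvgn_ge_cst cq _ => K.
Qed.

(** The defining identity determines [w], and the product of the series
[(1 - p^(-s))^(-(beta + 1))] satisfies it. The comparison is made at
integers [s > 1]. *)
Lemma zeta_power_coefE (beta : R) (w : nat -> R) : 0 < beta ->
  zeta_power_coef (beta + 1) w ->
  forall n, (0 < n)%N -> w n = multf (rbin (beta + 1)) n.
Proof.
move=> b0 zw n n0; apply/eqP; rewrite -subr_eq0; apply/eqP.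
apply: (@dirichlet_unique (fun n => w n - multf (rbin (beta + 1)) n)) n0 => K.
have K1 : 1 < K.+2%:R :> R by rewrite ltr1n.
have := zw _ K1; under eq_fun do under eq_bigr do rewrite powR_ninv.
have zetaE : (fun N => \sum_(1 <= n < N) n%:R `^ (- K.+2%:R)) =
    dsum (ninv K.+2) (fun=> 1 : R).
  by apply/funext => N; apply: eq_bigr => i _; rewrite powR_ninv mul1r.
rewrite /zeta zetaE => cw.
have cD : dsum (ninv K.+2) (multf (rbin (beta + 1))) @ \oo -->
   limn (dsum (ninv K.+2) (fun=> 1)) `^ (beta + 1).
  apply: dsum_rbin; rewrite ?addr_gt0//.
  - by move=> k; rewrite exprn_ge0// invr_ge0.
  - by move=> k l; rewrite /ninv natrM invfM exprMn.
  - by rewrite /ninv invr1 expr1n.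
  - exact: ninv_cvg.
rewrite (_ : dsum _ _ = (fun N => \sum_(1 <= i < N) w i * ninv K.+2 i
    - dsum (ninv K.+2) (multf (rbin (beta + 1))) N)).
  by have cB := cvgB cw cD; rewrite subrr in cB; exact: (cB _).
apply/funext => N; rewrite /dsum -sumrB; apply: eq_bigr => i _.
by rewrite mulrBl.
Qed.

End ZetaPower.

(** * Moment weights and hyponormality *)

Section ComplexDot.
Context {R : realType}.
Implicit Types (x y z : R[i]) (t : R).

(** The real inner product of complex numbers; all the forms below are real. *)
Definition cdot x y : R := complex.Re (x * y^*%C).

Lemma cdotE x y :
  cdot x y = complex.Re x * complex.Re y + complex.Im x * complex.Im y.
Proof. by case: x y => [a b] [c d]; rewrite /cdot /=; ring. Qed.

Lemma cdotC x y : cdot x y = cdot y x.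
Proof. by rewrite !cdotE; ring. Qed.

Lemma cdotBl x y z : cdot (x - y) z = cdot x z - cdot y z.
Proof. by case: x y z => [? ?] [? ?] [? ?]; rewrite !cdotE /=; ring. Qed.

Lemma cdotBr x y z : cdot x (y - z) = cdot x y - cdot x z.
Proof. by rewrite cdotC cdotBl !(cdotC x). Qed.

Lemma cdot0l x : cdot 0 x = 0.
Proof. by rewrite cdotE /=; ring. Qed.

Lemma cdot0r x : cdot x 0 = 0.
Proof. by rewrite cdotC cdot0l. Qed.

Lemma cdot_sumr (T : Type) (r : seq T) (P : pred T) (F : T -> R[i]) x :
  cdot x (\sum_(i <- r | P i) F i) = \sum_(i <- r | P i) cdot x (F i).
Proof.
elim/big_rec2: _ => [|i y z _ <-]; first exact: cdot0r.
by rewrite -[F i in LHS]opprK addrC cdotBr -[- F i]sub0r cdotBr cdot0r; ring.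
Qed.

Lemma cdot_suml (T : Type) (r : seq T) (P : pred T) (F : T -> R[i]) x :
  cdot (\sum_(i <- r | P i) F i) x = \sum_(i <- r | P i) cdot (F i) x.
Proof. by rewrite cdotC cdot_sumr; apply: eq_bigr => i _; rewrite cdotC. Qed.

Lemma normc_sqr x : normc x ^+ 2 = cdot x x.
Proof.
case: x => a b; rewrite cdotE /= sqr_sqrtr; first by ring.
by rewrite addr_ge0 ?sqr_ge0.
Qed.

Lemma psd_complex (K : nat -> nat -> R) : psd K -> forall s : seq (R[i] * nat),
  0 <= \sum_(p <- s) \sum_(q <- s) cdot p.1 q.1 * K p.2 q.2.
Proof.
move=> pK s.
have := addr_ge0 (pK [seq (complex.Re p.1, p.2) | p <- s])
                 (pK [seq (complex.Im p.1, p.2) | p <- s]).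
congr (_ <= _); rewrite !big_map -big_split; apply: eq_bigr => p _ /=.
rewrite !big_map -big_split; apply: eq_bigr => q _ /=.
by rewrite cdotE mulrDl.
Qed.

End ComplexDot.

Section MomentPositivity.
Context {R : realType}.
Variable v : nat -> R.

(** What is left of [v n = int |z^n|^2 dmu], with [mu] a measure on completely
multiplicative functions [z], if only Gram matrices are kept. The condition
[1 < c * m i * m i] keeps [v 1] out, where the weight [1 / (log n)^2] is
infinite. *)
Definition moment_weight := forall (c : nat) (m : nat -> nat),
  (forall i, (1 < c * m i * m i)%N) -> psd (fun i j => v (c * m i * m j)).

Lemma sum_classes (T U : eqType) (r : seq T) (f : T -> U) (F : T -> R) :
  \sum_(p <- r) F p =
  \sum_(c <- undup (map f r)) \sum_(p <- r | f p == c) F p.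
Proof.
rewrite (exchange_big_dep xpredT)//=; apply: eq_big_seq => p pr.
have fp : f p \in undup (map f r) by rewrite mem_undup map_f.
rewrite (big_rem _ fp) /= eqxx big1_seq ?addr0// => c /andP[/eqP <-].
by rewrite mem_rem_uniq ?undup_uniq// inE eqxx.
Qed.

Let grid (N : nat) : seq (nat * nat) :=
  [seq (k, l) | k <- index_iota 1 N, l <- index_iota 1 N].

(* With Y standing for the function sum_(k,l) Y (k,l) conj(z^k) z^l, this is the
   inner product of Y and Z in L^2(mu): the integral of conj(z^k) z^l z^k' conj(z^l')
   vanishes unless k' l = k l', and is then v (k' l). *)
Let Phi N (Y Z : nat * nat -> R[i]) : R :=
  \sum_(p <- grid N) \sum_(q <- grid N | (q.1 * p.2 == p.1 * q.2)%N)
    cdot (Y p) (Z q) * v (q.1 * p.2).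

Let mem_grid N p : (p \in grid N) = ((0 < p.1 < N)%N && (0 < p.2 < N)%N).
Proof.
case: p => k l; apply/allpairsP/idP => [[[k' l'] [/= + + [-> ->]]]|/= /andP[kN lN]].
  by rewrite !mem_index_iota => -> ->.
by exists (k, l); split; rewrite ?mem_index_iota.
Qed.

(* The lowest terms b / a of k / l. For k = b m, l = a m, k' = b m', l' = a m'
   the weight is v (a b m m'), so each class contributes a positive form. *)
Let ratio (p : nat * nat) := (p.1 %/ gcdn p.1 p.2, p.2 %/ gcdn p.1 p.2)%N.

Let ratioE p q : (0 < p.1)%N -> (0 < p.2)%N -> (0 < q.1)%N -> (0 < q.2)%N ->
  (ratio q == ratio p) = (q.1 * p.2 == p.1 * q.2)%N.
Proof.
case: p q => [k l] [k' l'] /= k0 l0 k0' l0'.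
have g0 : (0 < gcdn k l)%N by rewrite gcdn_gt0 k0.
have g0' : (0 < gcdn k' l')%N by rewrite gcdn_gt0 k0'.
have ek : (k = k %/ gcdn k l * gcdn k l)%N by rewrite divnK ?dvdn_gcdl.
have el : (l = l %/ gcdn k l * gcdn k l)%N by rewrite divnK ?dvdn_gcdr.
have ek' : (k' = k' %/ gcdn k' l' * gcdn k' l')%N by rewrite divnK ?dvdn_gcdl.
have el' : (l' = l' %/ gcdn k' l' * gcdn k' l')%N by rewrite divnK ?dvdn_gcdr.
rewrite /ratio /=.
have cop : coprime (k %/ gcdn k l) (l %/ gcdn k l).
  by rewrite /coprime -(eqn_pmul2r g0) muln_gcdl -ek -el mul1n.
have cop' : coprime (k' %/ gcdn k' l') (l' %/ gcdn k' l').
  by rewrite /coprime -(eqn_pmul2r g0') muln_gcdl -ek' -el' mul1n.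
move: (k %/ _)%N (l %/ _)%N (k' %/ _)%N (l' %/ _)%N ek el ek' el' cop cop'.
move: (gcdn k l) (gcdn k' l') g0 g0' => g g' g0 g0' a b a' b' ek el ek' el' cop cop'.
rewrite ek el ek' el'.
have -> : (a' * g' * (b * g) == a * g * (b' * g'))%N = (a' * b == a * b')%N.
  rewrite -(@eqn_pmul2r (g * g') (a' * b)) ?muln_gt0 ?g0//.
  by congr (_ == _); lia.
apply/eqP/eqP => [[-> ->]//|E].
have aa : a' = a.
  apply/eqP; rewrite eqn_dvd -(@Gauss_dvdl a' a b') // -E dvdn_mulr//=.
  by rewrite -(@Gauss_dvdl a a' b)// E dvdn_mulr.
have a0 : (0 < a)%N by move: k0; rewrite ek muln_gt0 => /andP[].
rewrite aa; congr pair; apply/eqP.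
by move/eqP: E; rewrite aa eqn_pmul2l// => /eqP ->.
Qed.

Let Phi_ge0 N Y : moment_weight -> Y (1%N, 1%N) = 0 -> 0 <= Phi N Y Y.
Proof.
move=> mv Y11.
have -> : Phi N Y Y = \sum_(c <- undup (map ratio (grid N)))
    \sum_(p <- grid N | ratio p == c) \sum_(q <- grid N | ratio q == c)
      cdot (Y p) (Y q) * v (q.1 * p.2).
  rewrite /Phi (sum_classes _ ratio); apply: eq_bigr => c _.
  rewrite big_seq_cond [RHS]big_seq_cond.
  apply: eq_bigr => p /andP[pr /eqP <-].
  move: pr; rewrite mem_grid => /andP[/andP[p1 _] /andP[p2 _]].
  rewrite big_seq_cond [RHS]big_seq_cond; apply: eq_bigl => q.
  apply: andb_id2l; rewrite mem_grid => /andP[/andP[q1 _] /andP[q2 _]].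
  by rewrite ratioE.
rewrite big_seq; apply: sumr_ge0 => c; rewrite mem_undup => /mapP[p0 p0r cE].
move: p0r; rewrite mem_grid => /andP[/andP[p1 _] /andP[p2 _]].
pose c' := (c.1 * c.2)%N.
have c0 : (0 < c')%N.
  rewrite /c' cE muln_gt0 /= !divn_gt0 ?gcdn_gt0 ?p1//.
  by rewrite (dvdn_leq p1 (dvdn_gcdl _ _)) (dvdn_leq p2 (dvdn_gcdr _ _)).
pose m i := if (1 < c' * i * i)%N then i else 2%N.
have m1 i : (1 < c' * m i * m i)%N.
  by rewrite /m; case: ifP => // _; lia.
have := psd_complex (mv c' m m1)
  [seq (Y p, gcdn p.1 p.2) | p <- grid N & ratio p == c].
congr (_ <= _); rewrite big_map big_filter big_seq_cond [RHS]big_seq_cond.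
have prE p : p \in grid N -> ratio p = c -> p != (1, 1)%N ->
   [/\ p.1 = c.1 * gcdn p.1 p.2, p.2 = c.2 * gcdn p.1 p.2
    & m (gcdn p.1 p.2) = gcdn p.1 p.2]%N.
  rewrite mem_grid => /andP[/andP[k0 _] /andP[l0 _]] rp pne.
  have e1 : (p.1 = c.1 * gcdn p.1 p.2)%N by rewrite -rp divnK// dvdn_gcdl.
  have e2 : (p.2 = c.2 * gcdn p.1 p.2)%N by rewrite -rp divnK// dvdn_gcdr.
  split=> //; rewrite /m ifT//.
  have -> : (c' * gcdn p.1 p.2 * gcdn p.1 p.2 = p.1 * p.2)%N.
    by rewrite /c' [in RHS]e1 [in X in (_ = _ * X)%N]e2; lia.
  rewrite ltn_neqAle muln_gt0 k0 l0 eq_sym muln_eq1 andbT.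
  by move: pne; rewrite [X in X != _]surjective_pairing xpair_eqE andbT.
apply: eq_bigr => p /andP[pr /eqP rp] /=; rewrite big_map big_filter.
rewrite big_seq_cond [RHS]big_seq_cond; apply: eq_bigr => q /andP[qr /eqP rq] /=.
have [->|pne] := eqVneq p (1, 1)%N; first by rewrite Y11 !cdot0l !mul0r.
have [->|qne] := eqVneq q (1, 1)%N; first by rewrite Y11 !cdot0r !mul0r.
have [e1 e2 ->] := prE p pr rp pne; have [f1 f2 ->] := prE q qr rq qne.
congr (_ * v _); rewrite [in RHS]f1 [in X in (_ = _ * X)%N]e2 /c'; lia.
Qed.

Let PhiC N Y Z : Phi N Y Z = Phi N Z Y.
Proof.
rewrite /Phi (exchange_big_dep xpredT)//=; apply: eq_bigr => q _.
apply: eq_big => p; first by rewrite eq_sym [(p.1 * _)%N]mulnC [(q.1 * _)%N]mulnC mulnC.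
by move=> /eqP E; rewrite cdotC E mulnC.
Qed.

Let PhiB N Y Z : Phi N (fun p => Y p - Z p) (fun p => Y p - Z p) =
  Phi N Y Y - Phi N Z Y *+ 2 + Phi N Z Z.
Proof.
rewrite mulr2n {1}(PhiC N Z Y) opprD addrA /Phi -!sumrB -big_split.
apply: eq_bigr => p _ /=; rewrite -!sumrB -big_split; apply: eq_bigr => q _ /=.
by rewrite cdotBl !cdotBr; ring.
Qed.

Let grid_sum N (A : nat * nat -> R) :
  \sum_(p <- grid N) A p = \sum_(1 <= k < N) \sum_(1 <= l < N) A (k, l).
Proof. exact: big_allpairs. Qed.

Let PhiE N Y Z : Phi N Y Z =
  \sum_(1 <= k < N) \sum_(1 <= l < N) \sum_(1 <= k' < N)
    \sum_(1 <= l' < N | (k' * l == k * l')%N)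
       cdot (Y (k, l)) (Z (k', l')) * v (k' * l).
Proof.
rewrite /Phi grid_sum; apply: eq_bigr => k _; apply: eq_bigr => l _.
rewrite big_mkcond grid_sum; apply: eq_bigr => k' _.
by rewrite [RHS]big_mkcond.
Qed.

Variables (F G h : nat -> R[i]) (N : nat).
Hypothesis F_supp : forall n, (N <= n)%N -> F n = 0.
Hypothesis G_supp : forall n, (N <= n)%N -> G n = 0.
Hypothesis h_supp : forall n, (N <= n)%N -> h n = 0.

(* y and f encode conj(h) G and F. *)
Let y (p : nat * nat) := (h p.1)^*%C * G p.2.
Let f (p : nat * nat) := if p.1 == 1%N then F p.2 else 0.
Let X := dconv h G.

(* The pointwise identity |conj(h) G| = |h G|: exchanging h k and h k' turns the
   expansion of the former into that of the latter. *)
Let Phi_yy : Phi N y y = \sum_(1 <= n < N * N) cdot (X n) (X n) * v n.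
Proof.
have -> : \sum_(1 <= n < N * N) cdot (X n) (X n) * v n =
   cdot (\sum_(1 <= n < N * N) ((v n)%:C%C * (X n)^*%C) * X n) 1.
  rewrite cdot_suml; apply: eq_bigr => n _; case: (X n) => a b.
  by rewrite !cdotE /=; ring.
rewrite sum_dconv_supp// cdot_suml.
transitivity (\sum_(1 <= k' < N) \sum_(1 <= l < N) \sum_(1 <= k < N)
   \sum_(1 <= l' < N | (k' * l == k * l')%N)
     cdot (y (k, l)) (y (k', l')) * v (k' * l)).
  rewrite PhiE exchange_big /= [RHS]exchange_big /=; apply: eq_bigr => l _.
  by rewrite exchange_big.
apply: eq_big_nat => k' /andP[k'0 _]; rewrite cdot_suml.
apply: eq_big_nat => l /andP[l0 _] /=.
transitivity (cdot (h k' * G l) (X (k' * l)) * v (k' * l)); last first.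
  rewrite [LHS]mulrC; case: (X _) (h k' * G l) => a b [c d].
  by rewrite !cdotE /=; ring.
rewrite /X (@dconv_supp _ _ _ N) ?muln_gt0 ?k'0// cdot_sumr big_distrl.
apply: eq_bigr => k _ /=; rewrite cdot_sumr big_distrl /=.
apply: eq_big => [l'|l' _]; first by rewrite eq_sym.
congr (_ * _); rewrite /y /=.
by case: (h k) (h k') (G l) (G l') => ? ? [? ?] [? ?] [? ?]; rewrite !cdotE /=; ring.
Qed.

Let Phi_f Z : Phi N f Z = \sum_(1 <= l < N) \sum_(1 <= k' < N)
  \sum_(1 <= l' < N | (k' * l == l')%N) cdot (F l) (Z (k', l')) * v (k' * l).
Proof.
rewrite PhiE; case: N => [|[|M]]; try by rewrite !big_geq.
rewrite big_nat_recl// [X in _ + X]big_nat_cond [X in _ + X]big1 ?addr0; last first.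
  move=> k /andP[/andP[k0 _] _]; do 3! (rewrite big1// => ? _).
  by rewrite /f /= eqSS; case: k k0 => //= k _; rewrite cdot0l mul0r.
apply: eq_bigr => l _; apply: eq_bigr => k' _.
by apply: eq_bigl => l'; rewrite mul1n.
Qed.

Let L := \sum_(1 <= n < N * N) ((v n)%:C%C * (G n)^*%C) * dconv h F n.

Let Phi_fy : Phi N f y = cdot L 1.
Proof.
rewrite Phi_f /L sum_dconv_supp// cdot_suml exchange_big /=.
apply: eq_big_nat => k /andP[k0 _]; rewrite cdot_suml.
apply: eq_big_nat => l /andP[l0 _].
transitivity (cdot (F l) (y (k, (k * l)%N)) * v (k * l)); last first.
  rewrite /y /=; case: (h k) (G _) (F l) => ? ? [? ?] [? ?].
  by rewrite !cdotE /=; ring.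
have [klN|klN] := ltnP (k * l) N; last first.
  rewrite /y G_supp// mulr0 cdot0r mul0r big_nat_cond big1// => l'.
  by move=> /andP[/andP[_ l'N] /eqP kl]; move: klN; rewrite kl leqNgt l'N.
have klr : (k * l)%N \in index_iota 1 N by rewrite mem_index_iota muln_gt0 k0 l0.
rewrite (big_rem _ klr) /= eqxx big1_seq ?addr0// => l' /andP[/eqP <-].
by rewrite mem_rem_uniq ?iota_uniq// inE eqxx.
Qed.

Let Phi_ff : Phi N f f = \sum_(1 <= l < N) cdot (F l) (F l) * v l.
Proof.
rewrite Phi_f; apply: eq_big_nat => l /andP[l0 lN].
have N1 : 1%N \in index_iota 1 N by rewrite mem_index_iota (leq_ltn_trans _ lN).
have lr : l \in index_iota 1 N by rewrite mem_index_iota l0.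
rewrite (big_rem _ N1) /= [X in _ + X]big1_seq ?addr0; last first.
  move=> k; rewrite mem_rem_uniq ?iota_uniq// inE => /and3P[_ /= k1 _].
  by rewrite big1// => l' _; rewrite /f /= (negPf k1) cdot0r mul0r.
rewrite (big_rem _ lr) /= mul1n eqxx big1_seq ?addr0// => l' /andP[/eqP <-].
by rewrite mem_rem_uniq ?iota_uniq// inE eqxx.
Qed.

(** This is [0 <= int |conj(h) G - F|^2 dmu], expanded. *)
Lemma moment_arith_mean_bound : moment_weight -> F 1%N = 0 -> G 1%N = 0 ->
  cdot L 1 *+ 2 <= \sum_(1 <= l < N) cdot (F l) (F l) * v l +
    \sum_(1 <= n < N * N) cdot (dconv h G n) (dconv h G n) * v n.
Proof.
move=> mv F1 G1; have Y1 : y (1%N, 1%N) - f (1%N, 1%N) = 0.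
  by rewrite /y /f /= F1 G1 mulr0 subr0.
have := @Phi_ge0 N (fun p => y p - f p) mv Y1.
rewrite PhiB Phi_yy Phi_fy Phi_ff => H; rewrite -subr_ge0; congr (_ <= _): H.
by rewrite /X; ring.
Qed.

End MomentPositivity.

Section MomentCauchySchwarz.
Context {R : realType}.

(** The inequality between arithmetic and geometric means, with the best
multiple [c = t * conj L]. *)
Lemma cauchy_schwarz_scaling (L : R[i]) (A B : R) : 0 <= A -> 0 <= B ->
  (forall c : R[i], cdot (c * L) 1 *+ 2 <= normc c ^+ 2 * A + B) ->
  normc L ^+ 2 <= A * B.
Proof.
move=> A0 B0 H; set n := normc L ^+ 2; have n0 : 0 <= n by exact: sqr_ge0.
have Ht (t : R) : t * n *+ 2 <= t ^+ 2 * n * A + B.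
  have := H (t%:C%C * L^*%C); congr (_ *+ 2 <= _ * A + B).
    by rewrite /n normc_sqr; case: L {H n n0} => a b; rewrite !cdotE /=; ring.
  by rewrite /n !normc_sqr; case: L {H n n0} => a b; rewrite !cdotE /=; ring.
have [Apos|] := ltP 0 A.
  have := Ht A^-1; have -> : A^-1 ^+ 2 * n * A = n / A by field; rewrite gt_eqF.
  by rewrite mulr2n [_ * n]mulrC lerD2l ler_pdivrMr// [B * A]mulrC.
move=> Ale; have {A0 Ale}A0 : A = 0 by apply/eqP; rewrite eq_le Ale.
rewrite A0 mul0r leNgt; apply/negP => npos.
have := Ht ((B + 1) / n); rewrite A0 divfK ?gt_eqF// mulr0 add0r mulr2n.
lra.
Qed.

(** Multiplication by [h] is a hyponormal operator for the weight [v]: pairing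
[F h] with [G] is pairing [F] with [conj(h) G], whose norm is that of [h G]. *)
Lemma moment_hyponormal (v : nat -> R) (F G h : nat -> R[i]) (N : nat) :
  (forall n, 0 <= v n) ->
  (forall n, (N <= n)%N -> F n = 0) -> (forall n, (N <= n)%N -> G n = 0) ->
  (forall n, (N <= n)%N -> h n = 0) -> moment_weight v ->
  F 1%N = 0 -> G 1%N = 0 ->
  normc (\sum_(1 <= n < N * N) (v n)%:C%C * (G n)^*%C * dconv h F n) ^+ 2 <=
  (\sum_(1 <= l < N) normc (F l) ^+ 2 * v l) *
  (\sum_(1 <= n < N * N) normc (dconv h G n) ^+ 2 * v n).
Proof.
move=> v0 Fs Gs hs mv F1 G1; apply: cauchy_schwarz_scaling.
- by apply: sumr_ge0 => i _; rewrite mulr_ge0 ?sqr_ge0.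
- by apply: sumr_ge0 => i _; rewrite mulr_ge0 ?sqr_ge0.
move=> c; have cFs n : (N <= n)%N -> c * F n = 0 by move=> /Fs ->; rewrite mulr0.
have cF1 : c * F 1%N = 0 by rewrite F1 mulr0.
have := moment_arith_mean_bound cFs Gs hs mv cF1 G1.
congr (_ *+ 2 <= _ + _).
- congr cdot; rewrite big_distrr; apply: eq_bigr => n _ /=.
  rewrite mulrCA; congr (_ * _); rewrite /dconv big_distrr.
  by apply: eq_bigr => k _ /=; ring.
- rewrite big_distrr; apply: eq_bigr => l _ /=.
  by rewrite -normc_sqr normcM exprMn mulrA.
- by apply: eq_bigr => n _; rewrite normc_sqr.
Qed.

End MomentCauchySchwarz.

(** * The logarithmic weight *)

Section Weights.
Context {R : realType}.
Implicit Types (rho : nat -> R) (w : nat -> R).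

(** The common features of the two families of weights, in terms of the values
[rho k] of [1 / w] at the [k]-th powers of primes. *)
Record hankel_ratio rho : Prop := HankelRatio {
  hratio0 : rho 0%N = 1;
  hratio_gt0 : forall k, 0 < rho k;
  hratio_le : forall k, rho k.+1 <= rho k;
  hratio_schur : forall e (a : nat -> nat),
    schur (fun i j => rho (e + a i + a j)%N) }.

Lemma weight_class_ratio w : weight_class w ->
  exists2 rho, hankel_ratio rho & forall n, (0 < n)%N -> (w n)^-1 = multf rho n.
Proof.
case=> beta b0 [wE|/(zeta_power_coefE b0) wE].
  exists (fun k => k.+1%:R `^ (- beta)).
    split; first by rewrite powR1.
    - by move=> k; apply: powR_gt0.
    - move=> k; rewrite !powRN lef_pV2 ?posrE ?powR_gt0//.
      by apply: ge0_ler_powR; rewrite ?nnegrE ?(ltW b0)// ler_nat.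
    - exact: schur_inv_power.
  by move=> n n0; rewrite wE// inv_num_divisors_powR.
exists (gratio beta).
  split; first exact: gratio0.
  - exact: gratio_gt0.
  - exact: gratio_le.
  - exact: schur_gratio.
move=> n n0; rewrite wE// /multf -prodfV; apply: eq_bigr => p _.
by rewrite -rbin_gratio// invrK.
Qed.

(** The weight [1 / (w n * (log n)^2)], with value [0] at [n = 1] by the
convention on division by zero. *)
Definition log_weight rho (n : nat) : R := multf rho n * (ln n%:R)^-1 ^+ 2.

(** With [x i = log c / 2 + log (m i)], the logarithm of [c * m i * m j] is
[x i + x j], so the logarithmic factor is the square of a Cauchy kernel. *)
Lemma moment_log_weight rho : hankel_ratio rho -> moment_weight (log_weight rho).
Proof.
move=> hr c m cm; apply: schur_psd; have c0 : (0 < c)%N.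
  by case: c cm => // /(_ 0%N); rewrite !mul0n.
have m0 i : (0 < m i)%N by case: (m i) (cm i) => //; rewrite !muln0.
have lnM' a b : (0 < a)%N -> (0 < b)%N ->
    ln (a * b)%:R = ln a%:R + ln b%:R :> R.
  by move=> a0 b0; rewrite natrM lnM// posrE ltr0n.
pose x i : R := ln c%:R / 2 + ln (m i)%:R.
have xE i j : x i + x j = ln (c * m i * m j)%:R.
  by rewrite !lnM' ?muln_gt0 ?c0 ?m0// /x; field.
have x0 i : 0 < x i.
  by rewrite -(pmulrn_lgt0 _ (ltn0Sn 1)) mulr2n xE ln_gt0// ltr1n.
apply: (schurM (schur_multf _ _ _ _)) => //; first exact: hratio0.
  exact: hratio_schur.
apply: eq_schur (schurM (schur_cauchy x0) (schur_cauchy x0)) => i j.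
by rewrite xE expr2.
Qed.

Lemma log_weight_ge0 rho n : hankel_ratio rho -> 0 <= log_weight rho n.
Proof.
move=> hr; rewrite mulr_ge0 ?sqr_ge0//.
by apply: multf_ge0 => k; rewrite ltW// hratio_gt0.
Qed.

Lemma log_weight_mull_le rho k l : hankel_ratio rho -> (0 < k)%N -> (1 < l)%N ->
  log_weight rho (k * l) <= log_weight rho l.
Proof.
case=> r0 rgt0 rle _ k0 l1; have l0 := ltnW l1.
have lnl : 0 < ln l%:R :> R by rewrite ln_gt0// ltr1n.
have lnkl : ln l%:R <= ln (k * l)%:R :> R.
  by rewrite ler_ln ?posrE ?ltr0n ?muln_gt0 ?k0// ler_nat leq_pmull.
have lnkl0 := lt_le_trans lnl lnkl.
apply: ler_pM; rewrite ?sqr_ge0//.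
- by apply: multf_ge0 => j; rewrite ltW.
- exact: multf_mull_le.
- by rewrite lerXn2r ?nnegrE ?invr_ge0 ?(ltW lnl) ?(ltW lnkl0)// lef_pV2.
Qed.

End Weights.

(** * Partial sums in the weighted space and the Hankel form *)

Section HardySpace.
Context {R : realType}.
Variable w : nat -> R.
Hypothesis w_gt0 : forall n, (0 < n)%N -> 0 < w n.
Implicit Types a : nat -> R[i].

Let t a n : R := normc (a n) ^+ 2 / w n.

Let t_ge0 a n : (0 < n)%N -> 0 <= t a n.
Proof. by move=> n0; rewrite divr_ge0 ?sqr_ge0 ?ltW ?w_gt0. Qed.

Lemma H2w_partial_le a N : in_H2w w a ->
  \sum_(1 <= n < N) normc (a n) ^+ 2 / w n <= H2w_norm w a ^+ 2.
Proof.
rewrite /in_H2w => fa.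
have t0 n : (1 <= n)%N -> true -> (0 <= (t a n)%:E)%E.
  by move=> n0 _; rewrite lee_fin t_ge0.
have ge0 : (0 <= H2w_normsq w a)%E by apply: nneseries_ge0 => n /t0; exact.
rewrite /H2w_norm sqr_sqrtr ?fine_ge0// -lee_fin fineK ?ge0_fin_numE//.
by rewrite -sumEFin; apply: nneseries_lim_ge.
Qed.

Lemma H2w_norm_ge0 a : 0 <= H2w_norm w a.
Proof. exact: sqrtr_ge0. Qed.

Lemma dirichlet_polynomial_H2w a : dirichlet_polynomial a -> in_H2w w a.
Proof.
case=> N aN; rewrite /in_H2w /H2w_normsq.
apply: (@le_lt_trans _ _ (\sum_(1 <= n < N.+1) t a n)%:E); last exact: ltry.
apply: lime_le; first by apply: is_cvg_nneseries => n n0 _; rewrite lee_fin t_ge0.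
apply: nearW => M; rewrite sumEFin lee_fin.
have tN n : (N.+1 <= n)%N -> t a n = 0.
  by move=> Nn; rewrite /t aN// normc0 expr0n mul0r.
rewrite -(@big_nat_supp R (t a) xpredT _ (M + N.+1) (leq_addl _ _) tN).
case: M => [|M].
  rewrite big_geq// big_nat_cond; apply: sumr_ge0 => n /andP[/andP[n0 _] _].
  by rewrite t_ge0.
rewrite [leRHS](@big_cat_nat _ _ _ M.+1) ?leq_addr//= lerDl big_nat_cond.
apply: sumr_ge0 => n /andP[/andP[Mn _] _]; rewrite t_ge0//.
exact: leq_trans Mn.
Qed.

Lemma H2w_tail a eps : in_H2w w a -> 0 < eps ->
  exists2 N, (0 < N)%N & forall P, \sum_(N <= n < P) normc (a n) ^+ 2 / w n <= eps.
Proof.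
move=> fa e0; pose S N := \sum_(1 <= n < N) t a n.
have nd : {homo S : m n / (m <= n)%N >-> m <= n}.
  apply/nondecreasing_seqP => -[|n]; first by rewrite /S !big_geq.
  by rewrite /S [leRHS]big_nat_recr//= lerDl t_ge0.
have cS : cvgn S.
  apply: nondecreasing_is_cvgn => //; exists (H2w_norm w a ^+ 2) => _ [n _ <-].
  exact: H2w_partial_le.
have [N _ HN] : \forall n \near \oo, limn S - eps <= S n.
  by apply: cvgr_ge cS _ _; rewrite ltrBlDr ltrDl.
exists N.+1 => // P; have [NP|PN] := leqP N.+1 P; last by rewrite big_geq ?ltW// ltnW.
have := nondecreasing_cvgn_le nd cS P; rewrite /S (@big_cat_nat _ _ _ N.+1)//=.
by have := HN N.+1 (leqnSn N); rewrite /S /t; lra.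
Qed.

End HardySpace.

Section Hankel.
Context {R : realType}.
Implicit Types (a b f g h : nat -> R[i]).

Lemma dconv_delta b n : (0 < n)%N ->
  dconv (fun k => (k == 1%N)%:R) b n = b n.
Proof.
move=> n0; have d1 : 1%N \in divisors n by rewrite -dvdn_divisors// dvd1n.
rewrite /dconv (big_rem _ d1) /= mul1r divn1 big1_seq ?addr0// => k.
rewrite mem_rem_uniq ?divisors_uniq// inE => /andP[_ /andP[k1 _]].
by rewrite (negPf k1) mul0r.
Qed.

Definition log_coef a (n : nat) : R[i] := a n * (ln n%:R : R)%:C%C.

Lemma log_coef1 a : log_coef a 1 = 0.
Proof. by rewrite /log_coef ln1 mulr0. Qed.

(** The derivation property of [log], that is [(ab)' = a'b + ab']. *)
Lemma log_coef_dconv a b n : (0 < n)%N ->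
  log_coef (dconv a b) n = dconv (log_coef a) b n + dconv a (log_coef b) n.
Proof.
move=> n0; rewrite /log_coef /dconv big_distrl -big_split; apply: eq_big_seq => k.
rewrite -dvdn_divisors// => kn; have k0 := dvdn_gt0 n0 kn.
have nk0 : (0 < n %/ k)%N by rewrite divn_gt0// dvdn_leq.
rewrite -[in ln n%:R](divnK kn) natrM lnM ?posrE ?ltr0n//= rmorphD /=.
by ring.
Qed.

(** The term [k = n] missing from the Volterra sum contains [log 1 = 0]. *)
Lemma volterraE g f n : (0 < n)%N ->
  volterra g f n = ((ln n%:R : R)^-1)%:C%C * dconv f (log_coef g) n.
Proof.
move=> n0; rewrite /volterra /dconv; congr (_ * _).
rewrite [RHS](bigID (fun k => k < n)%N) /= [X in _ + X]big1_seq ?addr0; last first.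
  move=> k; rewrite -leqNgt -dvdn_divisors// => /andP[nk kn].
  have -> : k = n by apply/eqP; rewrite eqn_leq nk dvdn_leq.
  by rewrite divnn n0 log_coef1 mulr0.
by apply: eq_bigr => k _; rewrite /log_coef mulrA.
Qed.

Lemma normc_real (x : R) : normc x%:C%C = `|x|.
Proof. by rewrite /normc /= expr0n addr0 sqrtr_sqr. Qed.

Lemma normc_ge0 (x : R[i]) : 0 <= normc x.
Proof. by case: x => a b; exact: sqrtr_ge0. Qed.

Lemma normcD_sqr_le (x y : R[i]) :
  normc (x + y) ^+ 2 <= normc x ^+ 2 *+ 2 + normc y ^+ 2 *+ 2.
Proof.
rewrite !normc_sqr; case: x y => [a b] [c d]; rewrite !cdotE /= -subr_ge0.
have := addr_ge0 (sqr_ge0 (a - c)) (sqr_ge0 (b - d)).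
by congr (_ <= _); ring.
Qed.

Lemma normc_sum_sqr_le (T : Type) (r : seq T) (z : T -> R[i]) :
  normc (\sum_(i <- r) z i) ^+ 2 <= (size r)%:R * \sum_(i <- r) normc (z i) ^+ 2.
Proof.
have cst (x : R) : \sum_(i <- r) x = (size r)%:R * x.
  by rewrite big_const_seq count_predT iter_addr_0 mulr_natl.
rewrite normc_sqr cdot_suml.
have -> : (size r)%:R * \sum_(i <- r) normc (z i) ^+ 2 =
    \sum_(i <- r) \sum_(j <- r) (normc (z i) ^+ 2 + normc (z j) ^+ 2) / 2.
  transitivity (\sum_(i <- r) ((size r)%:R * normc (z i) ^+ 2 +
                   \sum_(j <- r) normc (z j) ^+ 2) / 2).
    rewrite -big_distrl big_split /= -big_distrr /= cst.
    by field.
  by apply: eq_bigr => i _; rewrite -big_distrl big_split /= cst.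
apply: ler_sum => i _; rewrite cdot_sumr; apply: ler_sum => j _.
rewrite !normc_sqr; case: (z i) (z j) => [a b] [c d]; rewrite !cdotE /= -subr_ge0.
have := addr_ge0 (sqr_ge0 (a - c)) (sqr_ge0 (b - d)).
by rewrite -(pmulr_lge0 _ (ltr0n _ 2)) => ?; lra.
Qed.

End Hankel.

Section HankelBound.
Context {R : realType}.
Variables (w rho : nat -> R) (g : nat -> R[i]) (C : R).
Hypothesis hr : hankel_ratio rho.
Hypothesis wE : forall n, (0 < n)%N -> (w n)^-1 = multf rho n.
Hypothesis gC : forall f : nat -> R[i], in_H2w w f ->
  in_H2w w (volterra g f) /\
  H2w_norm w (volterra g f) <= C * H2w_norm w f.

Let v := log_weight rho.

Let w_gt0 n : (0 < n)%N -> 0 < w n.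
Proof.
by move=> n0; rewrite -invr_gt0 wE// multf_gt0// => k; exact: hratio_gt0.
Qed.

Let v_ge0 n : 0 <= v n. Proof. exact: log_weight_ge0. Qed.

Let v_log a n : (1 < n)%N -> normc (log_coef a n) ^+ 2 * v n = normc (a n) ^+ 2 / w n.
Proof.
move=> n1; have n0 := ltnW n1.
have l0 : 0 < ln n%:R :> R by rewrite ln_gt0// ltr1n.
rewrite /v /log_weight -wE// /log_coef normcM normc_real exprMn real_normK ?num_real//.
by have := w_gt0 n0; move: (w n) (normc _) => x y x0; field; rewrite !gt_eqF.
Qed.

Let v_volterra f n : (0 < n)%N ->
  normc (dconv f (log_coef g) n) ^+ 2 * v n = normc (volterra g f n) ^+ 2 / w n.
Proof.
move=> n0; rewrite volterraE// normcM normc_real exprMn real_normK ?num_real//.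
by rewrite /v /log_weight -wE//; ring.
Qed.

(* The symbol is, up to its constant term, the image of the constant 1. *)
Let symbol_tail eps : 0 < eps ->
  exists2 N, (0 < N)%N &
    forall P, \sum_(N <= n < P | (1 < n)%N) normc (g n) ^+ 2 / w n <= eps.
Proof.
move=> e0; pose d (n : nat) : R[i] := (n == 1%N)%:R.
have /(dirichlet_polynomial_H2w w_gt0)/gC[fin _] : dirichlet_polynomial d.
  by exists 1%N => n n1; rewrite /d gtn_eqF.
have [N N0 HN] := H2w_tail w_gt0 fin e0; exists N => // P.
apply: le_trans (HN P); rewrite big_mkcond; apply: ler_sum_nat => n /andP[Nn _].
have n0 := leq_trans N0 Nn; case: ifP => n1; last first.
  by rewrite divr_ge0 ?sqr_ge0// ltW// w_gt0.
have ln0 : ln n%:R != 0 :> R by rewrite gt_eqF// ln_gt0// ltr1n.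
rewrite volterraE// dconv_delta// /log_coef mulrCA -rmorphM /=.
by rewrite mulVf// mulr1.
Qed.

(* Half of the Hankel form, where only f is differentiated. *)
Let form f h (N : nat) :=
  \sum_(1 <= n < N) (v n)%:C%C * (log_coef g n)^*%C * dconv h (log_coef f) n.

(* Multiplication by a Dirichlet polynomial is bounded because v decreases along
   multiples. *)
Let tail_conv_le h (E : nat -> R[i]) (N P : nat) : (N <= P)%N ->
  (forall n, (N <= n)%N -> h n = 0) -> (forall n, (n <= 1)%N -> E n = 0) ->
  \sum_(1 <= n < P) normc (dconv h E n) ^+ 2 * v n <=
  (N%:R * \sum_(1 <= k < N) normc (h k) ^+ 2) *
     \sum_(1 <= l < P) normc (E l) ^+ 2 * v l.
Proof.
move=> NP hs E1.
pose psi l := normc (E l) ^+ 2 * v l.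
have psi0 l : 0 <= psi l by rewrite mulr_ge0 ?sqr_ge0.
have step1 n : (0 < n < P)%N -> normc (dconv h E n) ^+ 2 * v n <=
    N%:R * \sum_(1 <= k < N | (k %| n)%N) normc (h k) ^+ 2 * psi (n %/ k)%N.
  move=> nP; have /andP[n0 _] := nP.
  rewrite (dconv_dvdE _ _ nP) (@big_nat_supp _ _ _ N)//; last first.
    by move=> k Nk; rewrite hs// mul0r.
  rewrite -[X in normc X ^+ 2]big_filter.
  apply: le_trans (ler_wpM2r (v_ge0 n) (normc_sum_sqr_le _ _)) _.
  rewrite -mulrA; apply: ler_pM => //.
  - by rewrite mulr_ge0// sumr_ge0// => k _; exact: sqr_ge0.
  - rewrite ler_nat size_filter (leq_trans (count_size _ _))//.
    by rewrite size_iota leq_subr.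
  rewrite big_filter big_distrl /=; apply: ler_sum => k kn.
  have k0 := dvdn_gt0 n0 kn.
  rewrite normcM exprMn -mulrA ler_wpM2l ?sqr_ge0// /psi.
  have [l1|l1] := leqP (n %/ k) 1; first by rewrite E1// normc0 expr0n !mul0r.
  rewrite ler_wpM2l ?sqr_ge0// /v -{1}(divnK kn) mulnC.
  exact: log_weight_mull_le.
have step2 k : (0 < k)%N ->
    \sum_(1 <= n < P | (k %| n)%N) psi (n %/ k)%N <= \sum_(1 <= l < P) psi l.
  move=> k0.
  have -> : \sum_(1 <= n < P | (k %| n)%N) psi (n %/ k)%N =
     \sum_(1 <= n < P) \sum_(1 <= l < P | (k * l == n)%N) psi l.
    rewrite big_mkcond; apply: eq_big_nat => n /andP[n0 nP]; case: ifP => kn; last first.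
      by rewrite big1// => l /eqP kl; rewrite -kl dvdn_mulr in kn.
    have nk : ((1 <= n %/ k) && (n %/ k < P))%N.
      by rewrite divn_gt0// dvdn_leq//= (leq_ltn_trans (leq_div _ _)).
    rewrite (big_rem (n %/ k)%N) ?mem_index_iota//= mulnC divnK// eqxx.
    rewrite big1_seq ?addr0// => l /andP[/eqP <-]; rewrite mulKn//.
    by rewrite mem_rem_uniq ?iota_uniq// inE eqxx.
  rewrite (exchange_big_dep xpredT)//=; apply: ler_sum => l _.
  have [klP|klP] := boolP ((k * l)%N \in index_iota 1 P).
    rewrite (big_rem _ klP) /= eqxx big1_seq ?addr0// => n /andP[/eqP <-].
    by rewrite mem_rem_uniq ?iota_uniq// inE eqxx.
  by rewrite big1_seq// => n /andP[/eqP <- kl]; rewrite kl in klP.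
apply: (@le_trans _ _ (\sum_(1 <= n < P)
    N%:R * \sum_(1 <= k < N | (k %| n)%N) normc (h k) ^+ 2 * psi (n %/ k)%N)).
  by apply: ler_sum_nat => n; exact: step1.
rewrite -big_distrr -mulrA ler_wpM2l//= (exchange_big_dep xpredT)//=.
rewrite big_distrl; apply: ler_sum_nat => k /andP[k0 _] /=.
by rewrite -big_distrr /= ler_wpM2l ?sqr_ge0// step2.
Qed.

(* The symbol is truncated at M, far enough not to change the form. The tail E
   changes h * Dg by an amount that is small once M is large, at the price of a
   factor 2 in the squared norm. *)
Let form_le f h (N : nat) :
  (forall n, (N <= n)%N -> f n = 0) -> (forall n, (N <= n)%N -> h n = 0) ->
  normc (form f h (N * N)) <= 2 * `|C| * (H2w_norm w f * H2w_norm w h).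
Proof.
move=> fs hs.
have fH : in_H2w w f.
  by apply: dirichlet_polynomial_H2w => //; exists N => n /ltnW; exact: fs.
have hH : in_H2w w h.
  by apply: dirichlet_polynomial_H2w => //; exists N => n /ltnW; exact: hs.
set nf := H2w_norm w f; set nh := H2w_norm w h.
have nf0 : 0 <= nf := H2w_norm_ge0 _ _.
have nh0 : 0 <= nh := H2w_norm_ge0 _ _.
pose b := N%:R * \sum_(1 <= k < N) normc (h k) ^+ 2.
have b0 : 0 <= b by rewrite mulr_ge0// sumr_ge0// => k _; exact: sqr_ge0.
(* 2 b eps bounds the contribution of the tail of the symbol. *)
have main eps : 0 < eps -> normc (form f h (N * N)) ^+ 2 <=
    nf ^+ 2 * (2 * (C * nh) ^+ 2 + 2 * b * eps).
  move=> e0; have [N0 N0_gt0 HN0] := symbol_tail e0.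
  pose M := (N0 + N * N + N)%N.
  have NM : (N <= M)%N by rewrite leq_addl.
  have NNM : (N * N <= M)%N by rewrite /M addnAC leq_addl.
  have N0M : (N0 <= M)%N by rewrite /M -addnA leq_addr.
  have MMM : (M <= M * M)%N by case: (M) => // m; rewrite leq_pmulr.
  pose G n := if (n < M)%N then log_coef g n else 0.
  pose E n := if (n < M)%N then 0 else if (1 < n)%N then log_coef g n else 0.
  have Gs n : (M <= n)%N -> G n = 0 by rewrite /G leqNgt => /negPf ->.
  have Fs n : (M <= n)%N -> log_coef f n = 0.
    by move=> Mn; rewrite /log_coef fs ?mul0r// (leq_trans NM).
  have hsM n : (M <= n)%N -> h n = 0 by move=> Mn; rewrite hs// (leq_trans NM).
  have G1 : G 1%N = 0 by rewrite /G log_coef1; case: ifP.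
  have Fs' n : (N <= n)%N -> log_coef f n = 0.
    by move=> Nn; rewrite /log_coef fs ?mul0r.
  have -> : form f h (N * N) =
      \sum_(1 <= n < M * M) (v n)%:C%C * (G n)^*%C * dconv h (log_coef f) n.
    rewrite sum_dconv_supp// (@big_nat_supp _ _ _ N)//; last first.
      by move=> k Nk; rewrite big1// => l _; rewrite hs// mul0r mulr0.
    rewrite /form sum_dconv_supp//.
    apply: eq_big_nat => k /andP[_ kN].
    rewrite (@big_nat_supp _ _ _ N M)//; last first.
      by move=> l Nl; rewrite Fs'// !mulr0.
    apply: eq_big_nat => l /andP[_ lN]; rewrite /G ifT//.
    by rewrite (leq_trans _ NNM)// ltn_mul.
  have mv := moment_log_weight hr.
  apply: le_trans (moment_hyponormal v_ge0 Fs Gs hsM mv (log_coef1 f) G1) _.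
  apply: ler_pM.
  - by apply: sumr_ge0 => l _; rewrite mulr_ge0 ?sqr_ge0.
  - by apply: sumr_ge0 => l _; rewrite mulr_ge0 ?sqr_ge0.
  - apply: le_trans (H2w_partial_le w_gt0 M fH).
    apply: ler_sum_nat => l /andP[l0 _].
    have [l1|l1] := leqP l 1; last by rewrite v_log.
    have -> : l = 1%N by apply/eqP; rewrite eqn_leq l1.
    by rewrite log_coef1 normc0 expr0n mul0r divr_ge0 ?sqr_ge0// ltW// w_gt0.
  apply: (@le_trans _ _ (\sum_(1 <= n < M * M)
     (2 * (normc (volterra g h n) ^+ 2 / w n) + 2 * (normc (dconv h E n) ^+ 2 * v n)))).
    apply: ler_sum_nat => n /andP[n0 _]; rewrite -v_volterra//.
    have -> : dconv h G n = dconv h (log_coef g) n + - dconv h E n.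
      rewrite -sumrB; apply: eq_big_seq => k.
      rewrite -dvdn_divisors// => kn; rewrite -mulrBr; congr (_ * _).
      have nk0 : (0 < n %/ k)%N by rewrite divn_gt0 ?(dvdn_gt0 n0 kn)// dvdn_leq.
      rewrite /G /E; case: ltnP => _; first by rewrite subr0.
      case: ltnP => l1; first by rewrite subrr.
      have -> : (n %/ k)%N = 1%N by apply/eqP; rewrite eqn_leq l1.
      by rewrite log_coef1 subr0.
    rewrite mulrA [X in _ <= _ + X]mulrA -mulrDl ler_wpM2r//.
    by apply: le_trans (normcD_sqr_le _ _) _; rewrite normcN !mulr_natl.
  rewrite big_split /= -!big_distrr /=; apply: lerD.
    rewrite ler_wpM2l//; apply: (@le_trans _ _ (H2w_norm w (volterra g h) ^+ 2)).
      by apply: H2w_partial_le => //; case: (gC hH).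
    have [_ Th] := gC hH.
    by rewrite lerXn2r ?nnegrE ?H2w_norm_ge0// (le_trans _ Th)// H2w_norm_ge0.
  rewrite -mulrA ler_wpM2l//.
  have E1 n : (n <= 1)%N -> E n = 0.
    by rewrite /E leqNgt => /negPf ->; case: ifP.
  apply: le_trans (tail_conv_le (leq_trans NM MMM) hs E1) _.
  rewrite -/b ler_wpM2l//; apply: le_trans (HN0 (M * M)%N).
  have N0MM := leq_trans N0M MMM.
  rewrite (@big_cat_nat _ _ _ N0)//= [X in X + _]big_nat_cond.
  rewrite [X in X + _]big1 ?add0r; last first.
    move=> l /andP[/andP[_ lN0] _].
    by rewrite /E (leq_trans lN0 N0M) normc0 expr0n mul0r.
  rewrite [leRHS]big_mkcond; apply: ler_sum_nat => l /andP[Nl _].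
  rewrite /E; case: (ltnP l M) => _; last first.
    by case: ifP => l1; rewrite ?v_log// normc0 expr0n mul0r.
  rewrite normc0 expr0n mul0r; case: ifP => // _.
  by rewrite divr_ge0 ?sqr_ge0// ltW// w_gt0// (leq_trans N0_gt0).
have sq : normc (form f h (N * N)) ^+ 2 <= nf ^+ 2 * (2 * (C * nh) ^+ 2).
  apply/ler_addgt0Pr => e e0.
  have d0 : 0 < nf ^+ 2 * (2 * b) + 1.
    by apply: ltr_wpDl => //; exact: mulr_ge0 (sqr_ge0 nf) (mulr_ge0 (ler0n _ 2) b0).
  have := main _ (divr_gt0 e0 d0); move=> /le_trans; apply.
  rewrite mulrDr lerD2l mulrA [e / _]mulrC mulrA ler_piMl ?(ltW e0)//.
  by rewrite ler_pdivrMr// mul1r lerDl.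
rewrite -(@ler_pXn2r _ 2) ?nnegrE ?mulr_ge0 ?normc_ge0//.
apply: le_trans sq _; rewrite !exprMn real_normK ?num_real//.
have := mulr_ge0 (mulr_ge0 (sqr_ge0 nf) (sqr_ge0 C)) (sqr_ge0 nh).
lra.
Qed.

(** The constant term of [fh] is estimated directly; on the other terms
[log n] is distributed over the two factors, giving two half forms. *)
Lemma hankel_bounded_of_volterra : hankel_bounded w g.
Proof.
exists (normc (g 1%N) + 4 * `|C|) => f h [Nf fs] [Nh hs].
have fH : in_H2w w f by apply: dirichlet_polynomial_H2w => //; exists Nf.
have hH : in_H2w w h by apply: dirichlet_polynomial_H2w => //; exists Nh.
pose N := (Nf + Nh).+2.
have fs' n : (N <= n)%N -> f n = 0.
  by move=> Nn; apply: fs; apply: leq_trans Nn; rewrite /N; lia.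
have hs' n : (N <= n)%N -> h n = 0.
  by move=> Nn; apply: hs; apply: leq_trans Nn; rewrite /N; lia.
have convE n : dirichlet_mul f h n = dconv f h n by [].
have wn1 : (w 1)^-1 = 1 by rewrite wE// multf1.
have -> : hankel w g (dirichlet_mul f h) =
    \sum_(1 <= n < N * N) dconv f h n * (g n)^*%C / (w n)%:C%C.
  apply: (@lim_near_cst (R[i]^o)); first exact: norm_hausdorff.
  exists (N * N)%N => // M /= NM.
  apply: (@big_nat_supp _ _ xpredT) => // n Nn.
  rewrite convE (@dconv_supp _ _ _ N)//; last by apply: leq_trans Nn.
  rewrite big_nat_cond big1 ?mul0r// => k /andP[/andP[_ kN] _].
  rewrite big_nat_cond big1// => l /andP[/andP[_ lN] /eqP kl].
  by move: Nn; rewrite -kl leqNgt ltn_mul.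
have -> : \sum_(1 <= n < N * N) dconv f h n * (g n)^*%C / (w n)%:C%C =
    f 1%N * h 1%N * (g 1%N)^*%C + (form f h (N * N) + form h f (N * N)).
  have NN : (1 < N * N)%N by rewrite /N; lia.
  have v1 : v 1 = 0 by rewrite /v /log_weight ln1 invr0 expr0n mulr0.
  rewrite /form -big_split /= (big_ltn NN) [X in _ = _ + X](big_ltn NN).
  rewrite v1 !mul0r addr0 add0r; congr (_ + _).
    by rewrite /dconv /= !big_seq1 -rmorphV ?unitfE ?gt_eqF ?w_gt0// wn1 mulr1.
  apply: eq_big_nat => n /andP[n1 _]; have n0 := ltnW n1.
  have l0 : ln n%:R != 0 :> R by rewrite gt_eqF// ln_gt0// ltr1n.
  have wn0 := w_gt0 n0.
  rewrite (dconvC h)// -mulrDr -log_coef_dconv//.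
  rewrite /v /log_weight -wE// /log_coef.
  have -> : (g n * (ln n%:R)%:C)^*%C = (g n)^*%C * (ln n%:R)%:C%C.
    case: (g n) => a b; apply/eqP; rewrite eq_complex /=.
    by apply/andP; split; apply/eqP; ring.
  rewrite -rmorphV ?unitfE ?gt_eqF//.
  transitivity (dconv f h n * (g n)^*%C * ((w n)^-1 * (ln n%:R)^-1 ^+ 2 *
      (ln n%:R) * (ln n%:R))%:C%C).
    by congr (_ * (_%:C%C)); field; rewrite l0 gt_eqF.
  by rewrite !rmorphM /=; ring.
apply: le_trans (le_normcD _ _) _.
apply: le_trans (lerD (lexx _) (le_normcD _ _)) _.
have A := form_le fs' hs'; have B := form_le hs' fs'.
have coef1 a : in_H2w w a -> normc (a 1%N) <= H2w_norm w a.
  move=> /(H2w_partial_le w_gt0 2); rewrite big_nat1 wn1 mulr1.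
  by rewrite ler_pXn2r// nnegrE ?normc_ge0 ?H2w_norm_ge0.
have D : normc (f 1%N * h 1%N * (g 1%N)^*%C) <=
    normc (g 1%N) * (H2w_norm w f * H2w_norm w h).
  rewrite normcM [leLHS]mulrC normcM.
  have -> : normc (g 1%N)^*%C = normc (g 1%N).
    by case: (g 1%N) => a b; rewrite /= sqrrN.
  by rewrite ler_wpM2l ?normc_ge0// ler_pM ?normc_ge0 ?coef1.
rewrite -[leRHS]mulrA mulrDl; apply: lerD => //.
apply: le_trans (lerD A B) _; rewrite le_eqVlt; apply/orP; left; apply/eqP.
ring.
Qed.

End HankelBound.

Theorem theorem5 (R : realType) (w : nat -> R) (g : nat -> R[i]) :
  weight_class w -> dirichlet_class g ->
  volterra_bounded w g -> hankel_bounded w g.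
Proof.
move=> /weight_class_ratio[rho hr wE] _ [C gC].
exact: hankel_bounded_of_volterra hr wE gC.
Qed.
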